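(* Let $G$ be a closed subgroup of $S_{\infty}$, let $X=\langle X,\tau\rangle$ be a Polish $G$-space with a countable basis consisting of clopen sets, let $t$ be a nice topology for $X$ and let $\mathcal{B}=\{B_l:l\in\omega\}$ be its nice basis. Let $x\in X$ and let $\mathbb{A}$ be an admissible set such that $x$ is codable in $\mathbb{A}$ with respect to $\mathcal{B}$ and the relation $Imp$ (with respect to $\mathcal{B}$) is $\Sigma$-definable in $\mathbb{A}$. Then the piece $C$ of the canonical partition with respect to $\mathcal{B}$ with $x\in C$ coincides with the orbit $Gx$ if and only if $C$ is the intersection of all $G$-invariant Borel sets containing $x$ and constructible in $\mathbb{A}$ (with respect to $\mathcal{B}$).
   Context: **Group actions.** $S_\infty$ is the group of all permutations of $\omega$ with its usual Polish topology. A Polish $G$-space is a Polish space $X$ with a continuous action of $G$. $[\omega]^{<\omega}$ is the set of finite subsets of $\omega$; $S_{<\infty}$ is the set of all bijections between finite subsets of $\omega$; $S^G_{<\infty}=\{f|_d : f\in G,\ d\in[\omega]^{<\omega}\}$. For $\sigma\in S^G_{<\infty}$, $V^G_\sigma=\{f\in G: f\supseteq\sigma\}$; for finite $d\subseteq\omega$, $V^G_d=V^G_{id_d}$. $\mathcal{N}^G=\{V^G_\sigma:\sigma\in S^G_{<\infty}\}$. **Nice topology.** For $B\subseteq X$ and open $H\subseteq G$, the Vaught transform is $B^{*H}=\{x\in X:\{g\in H:gx\in B\}\text{ is comeagre in }H\}$. A topology $t$ on $X$ is nice for the $G$-space $(\langle X,\tau\rangle,G)$ if: (a) $t$ is Polish,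 finer than $\tau$, and the $G$-action remains continuous with respect to $t$; (b) there is a basis $\mathcal{B}$ of $t$ such that (i) $\mathcal{B}$ is countable; (ii) $B_1\cap B_2\in\mathcal{B}$ for all $B_1,B_2\in\mathcal{B}$; (iii) $X\setminus B\in\mathcal{B}$ for all $B\in\mathcal{B}$; (iv) $B^{*u}\in\mathcal{B}$ for all $B\in\mathcal{B}$ and $u\in\mathcal{N}^G$; (v) every $B\in\mathcal{B}$ is invariant under some open subgroup $H<G$. A basis satisfying (b) is called a nice basis. **Canonical partition.** The piece containing $x$ of the canonical partition with respect to $\mathcal{B}$ is $C=\bigcap\{GB:B\in\mathcal{B},\ x\in GB\}\cap\bigcap\{X\setminus GB:B\in\mathcal{B},\ x\notin GB\}$. **Admissible sets.** An admissible set $\mathbb{A}$ is a transitive model of KPU (Kripke–Platek set theory with urelements, in the sense of Barwise), regarded as a two-sorted structure in a language $L$ containing $\emptyset,\in$, with the KPU axiom schemes holding for all formulas of $L$. $\Sigma$-definable means definable by a $\Sigma$-formula (parameters allowed). $\omega$ is realizable in $\mathbb{A}$ if $\mathbb{A}$ contains a copy of $\langle\omega,<\rangle$ as an element (possibly consisting of urelements); then $\mathbb{A}$ also contains copies of $[\omega]^{<\omega}$ and $S_{<\infty}$ ordered by inclusion, and these sets are identified with their copies. **Multicodes.** In $\mathbb{A}$ define predicates $B_\Sigma,B_\Pi$ by simultaneous induction on ordinals $\alpha>0$: $B_\Sigma(1,u)$ iff $u$ is a function with $dom[u]=\omega$ and $rng[u]\subseteq\{0,1\}$; $B_\Pi(\alpha,u)$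 iff $u=(0,u')$ for some $u'$ with $B_\Sigma(\alpha,u')$; for $\alpha>1$, $B_\Sigma(\alpha,u)$ iff $u$ is a function, $dom[u]=\alpha$ if $\alpha$ is limit, $dom[u]=\omega$ if $\alpha$ is a successor, and for every $u'\in rng[u]$ there is $\beta<\alpha$ with $B_\Pi(\beta,u')$ or $B_\Sigma(\beta,u')$. For countable $\alpha$ such $u$ determines a Borel set $B_u$ (with respect to $\mathcal{B}=\{B_l:l\in\omega\}$): if $B_\Sigma(1,u)$ then $B_u=\bigcup\{B_n:u(n)=1\}$; if $B_\Pi(\alpha,u)$ with $u=(0,u')$ then $B_u=X\setminus B_{u'}$; if $\alpha>1$ and $B_\Sigma(\alpha,u)$ then $B_u=\bigcup\{B_{u'}:u'\in rng[u]\}$. A Borel set is constructible in $\mathbb{A}$ if it equals $B_u$ for some $u\in\mathbb{A}$ with $\mathbb{A}\models B_\Sigma(\alpha,u)$ or $\mathbb{A}\models B_\Pi(\alpha,u)$ for some countable ordinal $\alpha\in\mathbb{A}$. **Codability and $Imp$.** $x\in X$ is codable in $\mathbb{A}$ with respect to $\mathcal{B}$ if $\omega$ is realizable in $\mathbb{A}$ and the function $F_1:S_{<\infty}\to\mathbb{A}$ given by $F_1(\sigma)=\emptyset$ if $\sigma\notin S^G_{<\infty}$ and $F_1(\sigma)=\{l: V^G_\sigma x\cap B_l\neq\emptyset\}$ if $\sigma\in S^G_{<\infty}$ is an element of $\mathbb{A}$. The relation $Imp(c,l,k)$ holds iff $c\in[\omega]^{<\omega}$, $l,k\in\omega$ and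 $B_k\subseteq V^G_cB_l$. *)

(* Defs.v *)
From HB Require Import structures.
From mathcomp Require Import all_boot all_order all_algebra.
From mathcomp Require Import all_classical all_reals all_analysis.

Set Implicit Arguments.
Unset Strict Implicit.
Unset Printing Implicit Defensive.

Local Open Scope classical_set_scope.

(* A topology on [X] is a term of the HB class [Topological X], so that several
   topologies can coexist on one carrier. *)
Definition topsp (X : Type) (t : Topological X) : topologicalType :=
  Topological.Pack t.

Definition polish (R : realType) (T : topologicalType) : Prop :=
  (exists m : Metric R T, let M : metricType R := Metric.Pack m in
     @open M = @open T /\
     forall F : set_system M, ProperFilter F -> cauchy F ->
       exists l : M, F --> l) /\
  (exists2 D : set T, countable D & dense D).

Definition nowhere_dense (T : topologicalType) (A : set T) : Prop :=
  interior (closure A) = set0.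

Definition meagre (T : topologicalType) (A : set T) : Prop :=
  exists2 N : nat -> set T,
    (forall n, nowhere_dense (N n)) & A `<=` \bigcup_n N n.

Definition comeagre (T : topologicalType) (A : set T) : Prop := meagre (~` A).

Definition borel (T : topologicalType) : set (set T) := <<s @open T >>.

(* [set_type] carries the subspace topology, here that of pointwise
   convergence with [nat] discrete. *)
Definition Sinf : Type := set_type [set f : {ptws nat -> nat} | bijective f].
HB.instance Definition _ := Topological.on Sinf.

Definition perm_fun (f : Sinf) : nat -> nat := set_val f.
Coercion perm_fun : Sinf >-> Funclass.

Definition mkperm (f : nat -> nat) (fb : bijective f) : Sinf :=
  exist _ (f : {ptws nat -> nat})
    (mem_set (fb : [set f : {ptws nat -> nat} | bijective f] f)).

Lemma perm_fun_bij (f : Sinf) : bijective f.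
Proof. exact: set_valP f. Qed.

Lemma perm_fun_inj (f g : Sinf) : f =1 g -> f = g.
Proof. by move=> fg; apply: val_inj; apply: funext. Qed.

Lemma Sinf_inv_ex (f : Sinf) :
  exists g : nat -> nat, [/\ bijective g, cancel f g & cancel g f].
Proof.
by have [g fK gK] := perm_fun_bij f; exists g; split => //; exists f.
Qed.

Definition Sinf_one : Sinf := mkperm (inv_bij (fun=> erefl) : bijective id).
Definition Sinf_mul (f g : Sinf) : Sinf :=
  mkperm (bij_comp (perm_fun_bij f) (perm_fun_bij g)).
Definition Sinf_inv (f : Sinf) : Sinf :=
  mkperm (let: And3 gb _ _ := svalP (cid (Sinf_inv_ex f)) in gb).

Lemma Sinf_mulA : associative Sinf_mul.
Proof. by move=> f g h; exact: perm_fun_inj. Qed.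
Lemma Sinf_mul1 : left_id Sinf_one Sinf_mul.
Proof. by move=> f; exact: perm_fun_inj. Qed.
Lemma Sinf_1mul : right_id Sinf_one Sinf_mul.
Proof. by move=> f; exact: perm_fun_inj. Qed.
Lemma Sinf_mulV : left_inverse Sinf_one Sinf_inv Sinf_mul.
Proof.
move=> f; apply: perm_fun_inj => n; rewrite /perm_fun/=.
by case: (svalP (cid (Sinf_inv_ex f))) => _ fK _; exact: fK.
Qed.
Lemma Sinf_Vmul : right_inverse Sinf_one Sinf_inv Sinf_mul.
Proof.
move=> f; apply: perm_fun_inj => n; rewrite /perm_fun/=.
by case: (svalP (cid (Sinf_inv_ex f))) => _ _ gK; exact: gK.
Qed.

HB.instance Definition _ := isGroup.Build Sinf
  Sinf_mulA Sinf_mul1 Sinf_1mul Sinf_mulV Sinf_Vmul.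

Definition subgroup (G : set Sinf) : Prop :=
  [/\ G 1%g, (forall f g, G f -> G g -> G (f * g)%g)
    & (forall f, G f -> G (f^-1)%g)].

Section PermGroup.
Variable G : set Sinf.

(* Finite partial maps are identified with their graphs. *)
Definition Sfin : set (set (nat * nat)) :=
  [set s | [/\ finite_set s,
     (forall m n n', s (m, n) -> s (m, n') -> n = n')
   & (forall m m' n, s (m, n) -> s (m', n) -> m = m')]].

Definition restr (f : nat -> nat) (d : set nat) : set (nat * nat) :=
  [set (n, f n) | n in d].

Definition SGfin : set (set (nat * nat)) :=
  [set s | exists f : Sinf, exists d : set nat,
     [/\ G f, finite_set d & s = restr f d]].

Definition VG (s : set (nat * nat)) : set Sinf :=
  [set f : Sinf | G f /\ s `<=` [set p | f p.1 = p.2]].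

Definition VGset (d : set nat) : set Sinf := VG (restr id d).

Definition NG : set (set Sinf) := [set VG s | s in SGfin].

Definition open_subgroup (H : set Sinf) : Prop :=
  [/\ subgroup H, H `<=` G & open [set g : G | H (set_val g)]].

End PermGroup.

(* The action is a function on all of [Sinf] of which only the values on [G]
   are ever constrained or used. *)
Section Gspaces.
Variables (G : set Sinf) (X : Type) (act : Sinf -> X -> X).

Definition is_action : Prop :=
  (forall x, act 1%g x = x) /\
  (forall g h x, G g -> G h -> act (g * h)%g x = act g (act h x)).

Definition continuous_action (t : Topological X) : Prop :=
  continuous ((fun p => act (set_val p.1) p.2) : G * topsp t -> topsp t).

Definition polish_Gspace (R : realType) (t : Topological X) : Prop :=
  [/\ polish R (topsp t), is_action & continuous_action t].

Definition translate (H : set Sinf) (B : set X) : set X :=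
  [set y | exists g, exists2 b, H g /\ B b & y = act g b].

Definition orb (H : set Sinf) (x : X) : set X := [set act g x | g in H].

Definition invariant_under (H : set Sinf) (B : set X) : Prop :=
  forall g x, H g -> B x -> B (act g x).

(* [H] is seen as a topological space, with its subspace topology. *)
Definition vaught (B : set X) (H : set Sinf) : set X :=
  [set x | comeagre [set g : H | B (act (set_val g) x)]].

Definition nice_basis (t : Topological X) (Bs : set (set X)) : Prop :=
  @basis (topsp t) Bs /\
  [/\ countable Bs,
      (forall B1 B2, Bs B1 -> Bs B2 -> Bs (B1 `&` B2)),
      (forall B, Bs B -> Bs (~` B)),
      (forall B u, Bs B -> NG G u -> Bs (vaught B u))
    & (forall B, Bs B -> exists2 H, open_subgroup G H & invariant_under H B)].

Definition nice_topology (R : realType) (tau t : Topological X) : Prop :=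
  [/\ polish R (topsp t), @open (topsp tau) `<=` @open (topsp t),
      continuous_action t & exists Bs, nice_basis t Bs].

Definition canonical_piece (Bs : set (set X)) (x : X) : set X :=
  (\bigcap_(B in [set B | Bs B /\ translate G B x]) translate G B) `&`
  (\bigcap_(B in [set B | Bs B /\ ~ translate G B x]) ~` translate G B).

Definition Imp (B : nat -> set X) (c : set nat) (l k : nat) : Prop :=
  finite_set c /\ B k `<=` translate (VGset G c) (B l).

Definition F1 (B : nat -> set X) (x : X) (s : set (nat * nat)) : set nat :=
  [set l | SGfin G s /\ (orb (VG G s) x `&` B l) !=set0].

End Gspaces.

(* The cumulative hierarchy over a type [M] of urelements: well-founded trees
   (each node given by its urelements and its set members), modulo
   bisimulation. *)
Inductive tree (M : Type) : Type :=
  Tree (P : set M) (I : Type) (f : I -> tree M).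

Fixpoint bisim (M : Type) (a b : tree M) {struct a} : Prop :=
  match a, b with
  | @Tree _ P IX f, @Tree _ Q JX g =>
      [/\ P = Q, (forall i, exists j, bisim (f i) (g j))
        & (forall j, exists i, bisim (f i) (g j))]
  end.

Definition vset (M : Type) : Type :=
  {C : set (tree M) | exists t, C = bisim t}.

Definition obj (M : Type) : Type := (M + vset M)%type.

Section Hierarchy.
Variable M : Type.
Implicit Types (a b : vset M) (x y z : obj M).

Definition vclass (t : tree M) : vset M :=
  exist _ (bisim t) (ex_intro _ t erefl).

Definition vrep (a : vset M) : tree M := sval (cid (svalP a)).

Definition vin x y : Prop :=
  match y with
  | inl _ => False
  | inr a => match vrep a with
             | @Tree _ P IX f => match x with
                                | inl p => P p
                                | inr b => exists i, b = vclass (f i)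
                                end
             end
  end.

Definition members x : set (obj M) := [set z | vin z x].

Definition is_vset x : Prop := exists a, x = inr a.

(* The set of all [F i].  The index type has to live in the universe of the
   branching types of [tree], which lies strictly below that of [obj M]. *)
Definition collect (I : Type) (F : I -> obj M) : obj M :=
  inr (vclass (@Tree M [set p | exists i, F i = inl p]
    {i : I | exists b, F i = inr b} (fun i => vrep (sval (cid (svalP i)))))).

Definition collect_in (I : Type) (P : set I) (F : I -> obj M) : obj M :=
  collect (fun i : {i | P i} => F (sval i)).

Definition vempty : obj M := collect (fun i : void => match i with end).
Definition upair x y : obj M := collect (fun b : bool => if b then x else y).
Definition vone : obj M := upair vempty vempty.
Definition opair x y : obj M := upair (upair x x) (upair x y).

Definition is_function u : Prop :=
  [/\ is_vset u, (forall z, vin z u -> exists x y, z = opair x y)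
    & (forall x y y', vin (opair x y) u -> vin (opair x y') u -> y = y')].
Definition vdom u : set (obj M) := [set x | exists y, vin (opair x y) u].
Definition vrng u : set (obj M) := [set y | exists x, vin (opair x y) u].

Definition transitive_set x : Prop :=
  is_vset x /\ forall y z, vin y x -> vin z y -> vin z x.
Definition is_ordinal x : Prop :=
  transitive_set x /\ forall y, vin y x -> transitive_set y.
Definition is_successor x : Prop :=
  exists2 y, vin y x & forall z, vin z x <-> vin z y \/ z = y.
Definition is_limit x : Prop := x <> vempty /\ ~ is_successor x.

End Hierarchy.

Arguments vempty {M}.
Arguments vone {M}.

(* Symbols are those besides equality, [\in], the constant for the empty set
   and the predicate "is a urelement", which separates the two sorts. *)
Record language := Language {
  lrel : Type; rel_ar : lrel -> nat;
  lfun : Type; fun_ar : lfun -> nat }.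

Section Syntax.
Variable L : language.

Inductive term : Type :=
| TVar of nat
| TEmpty
| TApp (f : lfun L) of ('I_(fun_ar f) -> term).

(* De Bruijn variables; quantifiers range over urelements and sets alike.  In
   the bounded quantifiers the bound is a variable, which lives outside of the
   scope of the quantifier. *)
Inductive formula : Type :=
| FUrel of term
| FEq of term & term
| FMem of term & term
| FRel (r : lrel L) of ('I_(rel_ar r) -> term)
| FNot of formula
| FAnd of formula & formula
| FOr of formula & formula
| FAll of formula
| FEx of formula
| FBAll of nat & formula
| FBEx of nat & formula.

Fixpoint delta0 (p : formula) : bool :=
  match p with
  | FUrel _ | FEq _ _ | FMem _ _ | FRel _ _ => true
  | FNot p | FBAll _ p | FBEx _ p => delta0 p
  | FAnd p q | FOr p q => delta0 p && delta0 q
  | FAll _ | FEx _ => false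
  end.

Inductive sigma : formula -> Prop :=
| sigma_delta0 p : delta0 p -> sigma p
| sigma_and p q : sigma p -> sigma q -> sigma (FAnd p q)
| sigma_or p q : sigma p -> sigma q -> sigma (FOr p q)
| sigma_ball n p : sigma p -> sigma (FBAll n p)
| sigma_bex n p : sigma p -> sigma (FBEx n p)
| sigma_ex p : sigma p -> sigma (FEx p).

(* The universe consists of all urelements and of the sets in [sets]. *)
Record structure := Structure {
  urel : Type;
  sets : set (vset urel);
  rel_int : forall r : lrel L, ('I_(rel_ar r) -> obj urel) -> Prop;
  fun_int : forall f : lfun L, ('I_(fun_ar f) -> obj urel) -> obj urel }.

Variable A : structure.
Notation U := (obj (urel A)).

Definition dom : set U :=
  [set x | match x with inl _ => True | inr a => sets a end].

Definition vdomset : set U := [set x | dom x /\ is_vset x].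

Definition valuation (rho : nat -> U) : Prop := forall n, dom (rho n).

Definition scons (x : U) (rho : nat -> U) : nat -> U :=
  fun n => if n is m.+1 then rho m else x.

Fixpoint teval (rho : nat -> U) (s : term) : U :=
  match s with
  | TVar n => rho n
  | TEmpty => vempty
  | TApp f ts => fun_int (fun i => teval rho (ts i))
  end.

Fixpoint sat (rho : nat -> U) (p : formula) : Prop :=
  match p with
  | FUrel s => ~ is_vset (teval rho s)
  | FEq s s' => teval rho s = teval rho s'
  | FMem s s' => vin (teval rho s) (teval rho s')
  | FRel r ts => rel_int (fun i => teval rho (ts i))
  | FNot p => ~ sat rho p
  | FAnd p q => sat rho p /\ sat rho q
  | FOr p q => sat rho p \/ sat rho q
  | FAll p => forall x, dom x -> sat (scons x rho) p
  | FEx p => exists2 x, dom x & sat (scons x rho) p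
  | FBAll n p => forall x, dom x -> vin x (rho n) -> sat (scons x rho) p
  | FBEx n p => exists x, [/\ dom x, vin x (rho n) & sat (scons x rho) p]
  end.

(* Satisfaction of the axioms, with the schemes ranging over all formulas of
   the language and all values of their parameters. *)
Record KPU : Prop := {
  KPU_ext : forall a b, vdomset a -> vdomset b ->
    (forall x, dom x -> (vin x a <-> vin x b)) -> a = b;
  KPU_found : forall p rho, valuation rho ->
    (exists2 x, dom x & sat (scons x rho) p) ->
    exists x, [/\ dom x, sat (scons x rho) p
      & forall y, dom y -> vin y x -> ~ sat (scons y rho) p];
  KPU_pair : forall x y, dom x -> dom y ->
    exists2 a, vdomset a & vin x a /\ vin y a;
  KPU_union : forall a, vdomset a ->
    exists2 b, vdomset b & forall y x, dom y -> dom x ->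
      vin y a -> vin x y -> vin x b;
  KPU_sep : forall p rho a, delta0 p -> valuation rho -> vdomset a ->
    exists2 b, vdomset b & forall x, dom x ->
      (vin x b <-> vin x a /\ sat (scons x rho) p);
  KPU_coll : forall p rho a, delta0 p -> valuation rho -> vdomset a ->
    (forall x, dom x -> vin x a ->
       exists2 y, dom y & sat (scons y (scons x rho)) p) ->
    exists2 b, vdomset b & forall x, dom x -> vin x a ->
       exists y, [/\ dom y, vin y b & sat (scons y (scons x rho)) p] }.

Record admissible : Prop := {
  adm_empty : dom vempty;
  adm_trans : forall x y, dom y -> vin x y -> dom x;
  adm_fun : forall (f : lfun L) xs, (forall i, dom (xs i)) ->
    dom (@fun_int A f xs);
  adm_KPU : KPU }.

(* [e] enumerates a copy of [(nat, <)] that is an element of the structure.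
   Subsets of [nat] and finite partial maps are then identified with their
   images under [e]. *)
Section Copy.
Variable e : nat -> U.

Definition code_set (s : set nat) : U := collect_in s e.
Definition code_map (s : set (nat * nat)) : U :=
  collect_in s (fun p => opair (e p.1) (e p.2)).

Definition omega_copy : Prop :=
  injective e /\
  dom (opair (code_set setT) (code_map [set p | (p.1 < p.2)%N])).

(* The clauses are absolute for transitive sets, hence need no relativization
   to [dom].  The values 0 and 1 are the von Neumann ordinals, while the domain
   nat is its copy. *)
Inductive BSigma : U -> U -> Prop :=
| BSigma_one u : is_function u -> vdom u = range e ->
    vrng u `<=` [set vempty; vone] -> BSigma vone u
| BSigma_gt1 alpha u : is_ordinal alpha -> vin vone alpha -> is_function u ->
    (is_limit alpha -> vdom u = members alpha) ->
    (is_successor alpha -> vdom u = range e) ->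
    (forall u', vrng u u' ->
       exists2 beta, vin beta alpha & BPi beta u' \/ BSigma beta u') ->
    BSigma alpha u
with BPi : U -> U -> Prop :=
| BPi_intro alpha u : BSigma alpha u -> BPi alpha (opair vempty u).

Variables (G : set Sinf) (X : Type) (act : Sinf -> X -> X).
Variables (t : Topological X) (B : nat -> set X).

(* [Bcode u D]: the set [B_u] coded by [u] is [D]. *)
Inductive Bcode : U -> set X -> Prop :=
| Bcode_one u : BSigma vone u ->
    Bcode u (\bigcup_(n in [set n | vin (opair (e n) vone) u]) B n)
| Bcode_compl alpha u D : BSigma alpha u -> Bcode u D ->
    Bcode (opair vempty u) (~` D)
| Bcode_union alpha u (E : U -> set X) : vin vone alpha -> BSigma alpha u ->
    (forall u', vrng u u' -> Bcode u' (E u')) ->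
    Bcode u (\bigcup_(u' in vrng u) E u').

Definition constructible (D : set X) : Prop :=
  exists u alpha,
    [/\ dom u, dom alpha, countable (members alpha),
        BSigma alpha u \/ BPi alpha u & Bcode u D].

Definition codable (x : X) : Prop :=
  omega_copy /\
  (* Written [nat * nat -> Prop] and not [set (nat * nat)], whose universe is
     too high for an index type. *)
  dom (collect_in (I := nat * nat -> Prop) Sfin
    (fun s => opair (code_map s) (code_set (F1 G act B x s)))).

Definition Imp_sigma_definable : Prop :=
  exists p rho, [/\ sigma p, valuation rho
    & forall x y z, dom x -> dom y -> dom z ->
        (sat (scons x (scons y (scons z rho))) p <->
         exists c l k, [/\ Imp G act B c l k, x = code_set c, y = e l
                         & z = e k])].

(* [t] and the coarser Polish topology it refines have the same Borel sets. *)
Definition invariant_constructible (x : X) : set (set X) :=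
  [set D | [/\ @borel (topsp t) D, invariant_under act G D, D x
             & constructible D]].

End Copy.
End Syntax.

(* Main.v *)
Require Import Defs.
From mathcomp Require Import all_boot all_order all_algebra.
From mathcomp Require Import all_classical all_reals all_analysis.
Set Implicit Arguments.
Unset Strict Implicit.
Unset Printing Implicit Defensive.
Local Open Scope classical_set_scope.

(* Since [V_c B_l] is the complement of a Vaught transform of [~` B_l], it is
   clopen, and hence the piece [C] of [x] is the closure of [G x].  Codability
   puts codes for the closures of all the [V_s x] into [A], and Delta_0
   collection then yields codes for the invariant sets which describe finitely
   many rounds of a game between [x] and [y].  The set [C] is the one for zero
   rounds, which settles the case [C = G x].  Conversely, if [C] is contained
   in all of these sets, then, for every finite [c], [C] is a countable union
   of closures of sets [g V_c x], so that by Baire the closure of [V_c x] is a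
   neighbourhood of [x] in [C].  The same follows for all [y] in [C], and a
   back-and-forth construction then produces a [g] in [G] with [g x = y]. *)

(** * Sets as trees modulo bisimulation *)

(** The recursion behind the game sets is run outside of [A]: the number of rounds is a natural
    number, each round costs two levels of the Borel hierarchy, and the levels stay finite ordinals.
    Within [A] only one round is treated at a time, but for all positions [s] simultaneously, since
    a code for [s] refers to codes for infinitely many extensions of [s]. Positions range over all
    finite partial injections because these form the domain of the function supplied by codability;
    a position that no element of [G] extends has an empty set at round zero and so loses by itself.
    Finitely many rounds suffice because a finite set lies in some initial segment of length [N],
    which [N] rounds put into the domain, or into the range, of the final position. The countability
    that Baire asks for has the same origin: the translate by [g] of the orbit of [x] under the
    stabilizer of that segment depends only on the values of [g] there, which form a finite
    sequence. *)

Section Hierarchy.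
Variable M : Type.
Implicit Types (a b : vset M) (x y z u v w : obj M) (r s t : tree M).

Lemma bisim_refl t : bisim t t.
Proof. by elim: t => P I f IH /=; split=> // i; exists i. Qed.

Lemma bisim_sym s t : bisim s t -> bisim t s.
Proof.
elim: s t => P I f IH [Q J g] /= [-> h1 h2]; split=> // i.
  by have [j /IH] := h2 i; exists j.
by have [j /IH] := h1 i; exists j.
Qed.

Lemma bisim_trans s t r : bisim s t -> bisim t r -> bisim s r.
Proof.
elim: s t r => P I f IH [Q J g] [T K h] /= [-> h1 h2] [-> h3 h4]; split=> // i.
  by have [j fg] := h1 i; have [k gh] := h3 j; exists k; apply: IH gh.
by have [j gh] := h4 i; have [k fg] := h2 j; exists k; apply: IH gh.
Qed.

Lemma vclassP s t : vclass s = vclass t <-> bisim s t.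
Proof.
split=> [[st]|st]; first by rewrite st; exact: bisim_refl.
apply: eq_exist; apply/seteqP; split=> r /=; last exact: bisim_trans.
by apply: bisim_trans; exact: bisim_sym.
Qed.

Lemma vrepK a : vclass (vrep a) = a.
Proof.
case: a => C aP; apply: eq_exist; rewrite /vrep /=.
by case: cid => /= t.
Qed.

(** [vin] inspects a chosen representative; that representative is bisimilar to [Tree P f], which
    makes the choice immaterial. *)
Lemma vin_vclass x (P : set M) (I : Type) (f : I -> tree M) :
  vin x (inr (vclass (Tree P f))) <->
  match x with inl p => P p | inr b => exists i, b = vclass (f i) end.
Proof.
rewrite /vin; have := vrepK (vclass (Tree P f)).
case: (vrep _) => Q J g /vclassP /= [-> gf fg]; case: x => // b; split=> -[i ->].
  by have [j gj] := gf i; exists j; apply/vclassP.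
by have [j gj] := fg i; exists j; apply/vclassP/bisim_sym.
Qed.

Lemma vset_ext x y : is_vset x -> is_vset y ->
  (forall z, vin z x <-> vin z y) -> x = y.
Proof.
move=> [a ->] [b ->]; rewrite -(vrepK a) -(vrepK b).
case: (vrep a) (vrep b) => [P I f] [Q J g] ab; congr inr; apply/vclassP => /=.
split.
- apply/seteqP; split=> p; have := ab (inl p); rewrite !vin_vclass; tauto.
- move=> i; have := (ab (inr (vclass (f i)))).1; rewrite !vin_vclass.
  by move=> -[|j /vclassP ?]; [exists i|exists j].
- move=> j; have := (ab (inr (vclass (g j)))).2; rewrite !vin_vclass.
  by move=> -[|i /vclassP ?]; [exists j|exists i; exact: bisim_sym].
Qed.

Lemma vin_collect (I : Type) (F : I -> obj M) z :
  vin z (collect F) <-> exists i, F i = z.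
Proof.
rewrite vin_vclass; case: z => // b; split=> [[[i Fi] ->]|[i Fi]].
  by exists i => /=; case: cid => c /= ->; rewrite vrepK.
have iP : exists b, F i = inr b by exists b.
by exists (exist _ i iP) => /=; case: cid => c /=; rewrite Fi vrepK => -[].
Qed.

Lemma is_vset_collect (I : Type) (F : I -> obj M) : is_vset (collect F).
Proof. by eexists. Qed.

Lemma vin_collect_in (I : Type) (P : set I) (F : I -> obj M) z :
  vin z (collect_in P F) <-> exists2 i, P i & z = F i.
Proof.
rewrite vin_collect; split=> [[[i Pi] <-]|[i Pi ->]]; first by exists i.
by exists (exist _ i Pi).
Qed.

Lemma vin_is_vset z x : vin z x -> is_vset x.
Proof. by case: x => // a _; exists a. Qed.

Lemma vin_empty z : ~ vin z vempty.
Proof. by rewrite vin_collect => -[]. Qed.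

Lemma vin_upair z x y : vin z (upair x y) <-> z = x \/ z = y.
Proof.
rewrite vin_collect; split=> [[[] <-]|[] ->]; [by left|by right|..].
  by exists true.
by exists false.
Qed.

Lemma vin_one z : vin z vone <-> z = vempty.
Proof. by rewrite vin_upair; tauto. Qed.

Lemma vone_neq0 : vone <> vempty :> obj M.
Proof. by move=> v01; apply: (@vin_empty vempty); rewrite -v01 vin_one. Qed.

Lemma upair_inj x y x' y' : upair x y = upair x' y' ->
  (x = x' /\ y = y') \/ (x = y' /\ y = x').
Proof.
move=> xy; have H z : z = x \/ z = y <-> z = x' \/ z = y'.
  by rewrite -!vin_upair xy.
have := (H x).1 (or_introl erefl); have := (H y).1 (or_intror erefl).
have := (H x').2 (or_introl erefl); have := (H y').2 (or_intror erefl).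
by move=> [] ? [] ? [] ? [] ?; subst; tauto.
Qed.

Lemma opair_inj x y x' y' : opair x y = opair x' y' -> x = x' /\ y = y'.
Proof.
move=> /upair_inj[] [/upair_inj h1 /upair_inj h2].
  by case: h1 h2 => [] [? ?] [] [? ?]; subst.
by case: h1 h2 => [] [? ?] [] [? ?]; subst.
Qed.

Lemma vin_opair z x y :
  vin z (opair x y) <-> z = upair x x \/ z = upair x y.
Proof. exact: vin_upair. Qed.

Lemma opair_neq0 x y : opair x y <> vempty.
Proof.
by move=> xy; apply: (@vin_empty (upair x x)); rewrite -xy vin_opair; left.
Qed.

Lemma opair_neq1 x y : opair x y <> vone.
Proof.
move=> xy; have /vin_one xx : vin (upair x x) vone.
  by rewrite -xy vin_opair; left.
by apply: (@vin_empty x); rewrite -xx vin_upair; left.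
Qed.

Lemma vone_not_function : ~ is_function (vone : obj M).
Proof.
move=> [_ /(_ vempty) + _] => /(_ (proj2 (vin_one _) erefl))[x [y]] /esym.
exact: opair_neq0.
Qed.

(** [opair vempty u] has the member [vone], which is no ordered pair. Hence the code of a complement
    is never mistaken for the code of a union. *)
Lemma opair0_not_function u : ~ is_function (opair vempty u).
Proof.
move=> [_ /(_ vone) + _]; have v1 : vin vone (opair vempty u).
  by rewrite vin_opair; left.
by move=> /(_ v1)[x [y]] /esym; exact: opair_neq1.
Qed.

Lemma ordinal_one : is_ordinal (vone : obj M).
Proof.
split; first by split; [eexists|move=> y z /vin_one -> /vin_empty].
move=> y /vin_one ->; split; first by eexists.
by move=> ? ? /vin_empty.
Qed.

Lemma ordinal_succ x y : is_vset y -> is_ordinal x ->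
  (forall z, vin z y <-> vin z x \/ z = x) -> is_ordinal y.
Proof.
move=> vy [[vx tx] mx] xy; split; last first.
  by move=> z /xy[/mx//|->].
split=> // z w /xy[zx wz|-> wx]; apply/xy; left => //.
exact: tx wz.
Qed.

End Hierarchy.

(** * Delta_0 definability in an admissible set *)

Definition some_or (T : Type) (P : T -> Prop) (d : T) : T :=
  if pselect (exists v, P v) is left vP then sval (cid vP) else d.

Variant some_or_spec (T : Type) (P : T -> Prop) (d : T) : T -> Prop :=
| SomeOrSome v of P v : some_or_spec P d v
| SomeOrDefault of (forall v, ~ P v) : some_or_spec P d d.

Lemma some_orP (T : Type) (P : T -> Prop) (d : T) :
  some_or_spec P d (some_or P d).
Proof.
rewrite /some_or; case: pselect => [vP|nP]; first by constructor; exact: svalP.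
by constructor => v Pv; apply: nP; exists v.
Qed.

Section Definability.
Variables (L : language) (A : structure L).
Hypothesis A_adm : admissible A.
Notation U := (obj (urel A)).
Notation dom := (@Defs.dom L A).
Notation val := (@valuation L A).
Implicit Types (P Q : (nat -> U) -> Prop) (r : nat -> U) (f g : (nat -> U) -> U).

(* Quantifying over [s] builds closure under renaming of variables into the
   definition, so that formulas never have to be renamed. *)
Definition Delta0 P := forall s : nat -> nat, exists2 p : formula L, delta0 p &
  forall r, val r -> (sat r p <-> P (fun n => r (s n))).

Definition tail r : nat -> U := fun n => r n.+1.

Lemma val_scons x r : dom x -> val r -> val (scons x r).
Proof. by move=> xA rA [|n] /=. Qed.

Lemma vin_dom x y : vin x y -> dom y -> dom x.
Proof. by move=> xy yA; exact: (adm_trans A_adm) xy. Qed.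

Lemma Delta0_ext P Q :
  (forall r, val r -> (P r <-> Q r)) -> Delta0 P -> Delta0 Q.
Proof.
move=> PQ dP s; have [p p0 pP] := dP s; exists p => // r rA.
by rewrite pP// PQ// => n.
Qed.

Lemma Delta0_ren (h : nat -> nat) P :
  Delta0 P -> Delta0 (fun r => P (fun n => r (h n))).
Proof. by move=> dP s; have [p p0 pP] := dP (s \o h); exists p. Qed.

Lemma Delta0_eq i j : Delta0 (fun r => r i = r j).
Proof. by move=> s; exists (FEq (TVar L (s i)) (TVar L (s j))). Qed.

Lemma Delta0_eq0 i : Delta0 (fun r => r i = vempty).
Proof. by move=> s; exists (FEq (TVar L (s i)) (TEmpty L)). Qed.

Lemma Delta0_mem i j : Delta0 (fun r => vin (r i) (r j)).
Proof. by move=> s; exists (FMem (TVar L (s i)) (TVar L (s j))). Qed.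

Lemma Delta0_not P : Delta0 P -> Delta0 (fun r => ~ P r).
Proof.
move=> dP s; have [p p0 pP] := dP s; exists (FNot p) => // r rA /=.
by rewrite pP.
Qed.

Lemma Delta0_vset i : Delta0 (fun r => is_vset (r i)).
Proof.
move=> s; exists (FNot (FUrel (TVar L (s i)))) => // r rA /=.
by split=> [/contrapT|vr]; last exact.
Qed.

Lemma Delta0_and P Q : Delta0 P -> Delta0 Q -> Delta0 (fun r => P r /\ Q r).
Proof.
move=> dP dQ s; have [p p0 pP] := dP s; have [q q0 qQ] := dQ s.
exists (FAnd p q) => [/=|r rA /=]; first by rewrite p0.
by rewrite pP// qQ.
Qed.

Lemma Delta0_or P Q : Delta0 P -> Delta0 Q -> Delta0 (fun r => P r \/ Q r).
Proof.
move=> dP dQ s; have [p p0 pP] := dP s; have [q q0 qQ] := dQ s.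
exists (FOr p q) => [/=|r rA /=]; first by rewrite p0.
by rewrite pP// qQ.
Qed.

Definition upr (s : nat -> nat) : nat -> nat := fun n => if n is m.+1 then (s m).+1 else 0.

Lemma scons_upr s x r :
  (fun n => scons x r (upr s n)) = scons x (fun n => r (s n)).
Proof. by apply: funext => -[]. Qed.

Lemma Delta0_ex i P :
  Delta0 P -> Delta0 (fun r => exists2 x, vin x (r i) & P (scons x r)).
Proof.
move=> dP s; have [p p0 pP] := dP (upr s).
exists (FBEx (s i) p) => // r rA /=; split=> [[x [xA xr]]|[x xr Px]].
  by rewrite pP ?scons_upr; [exists x|exact: val_scons].
have xA := vin_dom xr (rA _).
by exists x; split=> //; rewrite pP ?scons_upr//; exact: val_scons.
Qed.

Lemma Delta0_all i P :
  Delta0 P -> Delta0 (fun r => forall x, vin x (r i) -> P (scons x r)).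
Proof.
move=> /Delta0_not/(Delta0_ex i)/Delta0_not; apply: Delta0_ext => r rA.
split=> [h x xi|h [x xi]]; last by apply; exact: h.
by apply: contrapT => nP; apply: h; exists x.
Qed.

Lemma Delta0_upair i j k : Delta0 (fun r => r i = upair (r j) (r k)).
Proof.
apply: Delta0_ext (Delta0_and (Delta0_vset i)
  (Delta0_and (Delta0_and (Delta0_mem j i) (Delta0_mem k i))
  (Delta0_all i (Delta0_or (Delta0_eq 0 j.+1) (Delta0_eq 0 k.+1))))) => r rA /=.
split=> [[vi [[ji ki] h]]|->].
  apply: vset_ext => //; first exact: is_vset_collect.
  by move=> z; rewrite vin_upair; split=> [/h//|[] ->].
split; first exact: is_vset_collect.
split; first by split; apply/vin_upair; [left|right].
by move=> z /vin_upair.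
Qed.

Lemma Delta0_opair i j k : Delta0 (fun r => r i = opair (r j) (r k)).
Proof.
apply: Delta0_ext (Delta0_ex i (Delta0_ex i.+1 (Delta0_and
  (Delta0_and (Delta0_upair 1 j.+2 j.+2) (Delta0_upair 0 j.+2 k.+2))
  (Delta0_upair i.+2 1 0)))) => r rA /=.
split=> [[a _ [b _ [[-> ->] ->]]]//|->].
exists (upair (r j) (r j)); first by apply/vin_opair; left.
by exists (upair (r j) (r k)) => //; apply/vin_opair; right.
Qed.

(** The components of a Kuratowski pair are members of its members, so the quantifiers over [x] and
    [y] can be bounded. *)
Lemma Delta0_ex_opair i P : Delta0 P ->
  Delta0 (fun r => exists x y, r i = opair x y /\ P (scons y (scons x r))).
Proof.
(* [h] skips [a] and [b], the two members of the pair, which are bound only in order to reach [x]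
   and [y]. *)
move=> dP; pose h n := match n with 0 => 0 | 1 => 2 | n.+2 => n.+4 end.
have hE a x b y r :
    (fun n => scons y (scons b (scons x (scons a r))) (h n)) =
    scons y (scons x r).
  by apply: funext => -[|[|n]].
apply: Delta0_ext (Delta0_ex i (Delta0_ex 0 (Delta0_ex i.+2 (Delta0_ex 0
  (Delta0_and (Delta0_opair i.+4 2 0) (Delta0_ren h dP)))))) => r rA /=.
split=> [[a _ [x _ [b _ [y _ [-> ]]]]]|[x [y [-> Pxy]]]].
  by rewrite hE => Pxy; exists x, y.
exists (upair x x); first by apply/vin_opair; left.
exists x; first by apply/vin_upair; left.
exists (upair x y); first by apply/vin_opair; right.
exists y; first by apply/vin_upair; right.
by rewrite hE.
Qed.

Lemma dom_upair x y : dom x -> dom y -> dom (upair x y).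
Proof.
move=> xA yA; have rA : val (scons x (scons y (fun=> x))).
  by apply: val_scons => //; exact: val_scons.
have [a [aA av] [xa ya]] := KPU_pair (adm_KPU A_adm) xA yA.
have [p p0 pP] := Delta0_or (Delta0_eq 0 1) (Delta0_eq 0 2) id.
have [b [bA bv] bP] := KPU_sep (adm_KPU A_adm) p0 rA (conj aA av).
suff -> : upair x y = b by [].
apply: vset_ext => //; first exact: is_vset_collect.
move=> z; rewrite vin_upair; split=> [zxy|].
  have za : vin z a by case: zxy => ->.
  apply/bP; first exact: vin_dom za aA.
  by split=> //; apply/pP => //; apply: val_scons => //; exact: vin_dom za aA.
move=> zb; have zA := vin_dom zb bA.
have := (bP _ zA).1 zb => -[_] /pP; apply; exact: val_scons.
Qed.

Lemma dom_opair x y : dom x -> dom y -> dom (opair x y).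
Proof. by move=> xA yA; do !apply: dom_upair. Qed.

Lemma separation P r a : Delta0 P -> val r -> dom a ->
  exists b, [/\ dom b, is_vset b & forall x, vin x b <-> vin x a /\ P (scons x r)].
Proof.
move=> dP rA aA; have [av|nav] := pselect (is_vset a); last first.
  exists vempty; split; [exact: (adm_empty A_adm)|exact: is_vset_collect|].
  by move=> x; split=> [/vin_empty//|[/vin_is_vset]].
have [p p0 pP] := dP id.
have [b [bA bv] bP] := KPU_sep (adm_KPU A_adm) p0 rA (conj aA av).
exists b; split=> // x; split=> [xb|[xa Px]].
  have xA := vin_dom xb bA.
  have [xa /pP Px] := (bP _ xA).1 xb; split=> //; apply: Px; exact: val_scons.
have xA := vin_dom xa aA; apply/bP => //; split=> //.
by apply/pP => //; exact: val_scons.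
Qed.

Lemma dom_union a : dom a ->
  exists2 b, dom b & forall x y, vin x y -> vin y a -> vin x b.
Proof.
move=> aA; have [av|nav] := pselect (is_vset a); last first.
  exists vempty; first exact: (adm_empty A_adm).
  by move=> x y _ /vin_is_vset.
have [b [bA bv] bP] := KPU_union (adm_KPU A_adm) (conj aA av).
exists b => // x y xy ya; have yA := vin_dom ya aA.
by apply: (bP y) => //; exact: vin_dom xy yA.
Qed.

Lemma dom_succ a : dom a ->
  exists b, [/\ dom b, is_vset b & forall z, vin z b <-> vin z a \/ z = a].
Proof.
move=> aA; have [b bA bP] := dom_union (dom_upair aA (dom_upair aA aA)).
have [c [cA cv cP]] := @separation _ (fun=> a) b
  (Delta0_or (Delta0_mem 0 1) (Delta0_eq 0 1)) (fun=> aA) bA.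
exists c; split=> // z; rewrite cP /=; split=> [[]//|zP]; split=> //.
case: zP => [za|->]; first by apply: (bP z a) => //; apply/vin_upair; left.
by apply: (bP a (upair a a)); apply/vin_upair; [left|right].
Qed.

(** Variable 0 stands for the value and the arguments are shifted by one. Composing two such
    functions would in general need an unbounded quantifier over the intermediate value, so each
    closure property below has to find its own bound. *)
Definition Dfun f :=
  (forall r, val r -> dom (f r)) /\ Delta0 (fun r => r 0 = f (tail r)).

(** Collection only yields a superset of the image; Delta_0 separation trims it, the argument [x]
    being bounded by [a]. *)
Lemma replacement f r a : Dfun f -> val r -> dom a ->
  exists b, [/\ dom b, is_vset b
    & forall y, vin y b <-> exists2 x, vin x a & y = f (scons x r)].
Proof.
move=> [fA df] rA aA; have [av|nav] := pselect (is_vset a); last first.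
  exists vempty; split; [exact: (adm_empty A_adm)|exact: is_vset_collect|].
  by move=> x; split=> [/vin_empty//|[y /vin_is_vset]].
have [p p0 pP] := df id.
have [|c [cA cv] cP] := KPU_coll (adm_KPU A_adm) p0 rA (conj aA av).
  move=> x xA xa; exists (f (scons x r)); first by apply: fA; exact: val_scons.
  by apply/pP => //; do !apply: val_scons => //; apply: fA; exact: val_scons.
have dQ : Delta0 (fun r' => exists2 x, vin x (r' 1) & r' 0 = f (scons x (fun n => r' n.+2))).
  pose h n := match n with 0 => 1 | 1 => 0 | n.+2 => n.+3 end.
  apply: Delta0_ext (Delta0_ex 1 (Delta0_ren h df)) => r' _ /=.
  by split=> -[x xr ->]; exists x => //; congr f; apply: funext => -[].
have [b [bA bv bP]] := separation dQ (val_scons aA rA) cA.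
exists b; split=> // y; rewrite bP /=; split=> [[_]//|[x xa ->]].
have xA := vin_dom xa aA; have [z [zA zc]] := cP x xA xa.
have vzx : val (scons z (scons x r)) by do !apply: val_scons.
move=> /(pP _ vzx) zf; have <- : z = f (scons x r) by [].
by split=> //; exists x.
Qed.

Lemma Dfun_var i : Dfun (fun r => r i).
Proof. by split; [move=> r|exact: Delta0_eq]. Qed.

Lemma Dfun_empty : Dfun (fun=> vempty).
Proof. by split; [move=> r _; exact: adm_empty|exact: Delta0_eq0]. Qed.

(** Prepared for graphs of pairs: variables 0 and 1 are the second and the first component, 2 is the
    pair, and the arguments start at 3. *)
Lemma Delta0_Dfun2 f : Dfun f ->
  Delta0 (fun r => r 0 = f (fun n => r n.+3)) /\
  Delta0 (fun r => r 1 = f (fun n => r n.+3)).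
Proof.
move=> [_ df]; split.
  by have := Delta0_ren (fun n => if n is m.+1 then m.+3 else 0) df.
by have := Delta0_ren (fun n => if n is m.+1 then m.+3 else 1) df.
Qed.

Lemma Dfun_opair f g : Dfun f -> Dfun g -> Dfun (fun r => opair (f r) (g r)).
Proof.
move=> Df Dg; split=> [r rA|]; first by apply: dom_opair; [case: Df|case: Dg] => + _; exact.
have [_ df] := Delta0_Dfun2 Df; have [dg _] := Delta0_Dfun2 Dg.
apply: Delta0_ext (Delta0_ex_opair 0 (Delta0_and df dg)) => r rA /=.
by split=> [[x [y [-> [-> ->]]]]//|->]; exists (f (tail r)), (g (tail r)).
Qed.

Lemma Dfun_one : Dfun (fun=> vone).
Proof.
split=> [r _|]; first by apply: dom_upair; exact: (adm_empty A_adm).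
apply: Delta0_ext (Delta0_ex 0 (Delta0_and (Delta0_eq0 0) (Delta0_upair 1 0 0))).
move=> r _ /=; split=> [[x _ [-> ->]]//|->].
by exists vempty => //; apply/vin_one.
Qed.

Lemma Dfun_if P f g : Delta0 P -> Dfun f -> Dfun g ->
  Dfun (fun r => if pselect (P r) then f r else g r).
Proof.
move=> dP [fA df] [gA dg]; split=> [r rA|]; first by case: pselect => ?; [exact: fA|exact: gA].
have dP' := Delta0_ren S dP.
apply: Delta0_ext (Delta0_or (Delta0_and dP' df) (Delta0_and (Delta0_not dP') dg)).
move=> r rA /=; rewrite /tail; case: pselect => Pr /=; tauto.
Qed.

(* The value [v] such that [P (scons v r)], provided it is unique among the
   second components of the members of [r i]. *)
Lemma Dfun_iota i P f :
  (forall r v, val r -> P (scons v r) -> exists s, vin (opair s v) (r i)) ->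
  Delta0 P -> Dfun f ->
  exists2 g, Dfun g & forall r, val r ->
    (forall v, P (scons v r) -> (forall v', P (scons v' r) -> v' = v) -> g r = v) /\
    ((forall v, ~ P (scons v r)) -> g r = f r).
Proof.
move=> Pi dP [fA df]; pose h n := if n is m.+1 then m.+4 else 0.
have hE v s z r v0 : (fun n => scons v (scons s (scons z (scons v0 r))) (h n)) = scons v r.
  by apply: funext => -[].
(* Uniqueness is a bounded statement, since by [Pi] every candidate is a second component of a
   member of [r i]; so is the existence of [v]. *)
pose R v r := P (scons v r) /\ forall v', P (scons v' r) -> v' = v.
have dR : Delta0 (fun r => R (r 0) (tail r)).
  apply: Delta0_ext (Delta0_and dP (Delta0_all i.+1 (Delta0_not (Delta0_ex_opair 0
    (Delta0_and (Delta0_ren h dP) (Delta0_not (Delta0_eq 0 3))))))) => r rA /=.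
  have rE : r = scons (r 0) (tail r) by apply: funext => -[].
  rewrite /R -rE; split=> -[Pr uP]; split=> //.
    move=> v' Pv'; apply: contrapT => v'0.
    have [|s sv'] := Pi (tail r) v' _ Pv'; first by move=> n; exact: rA.
    by apply: (uP _ sv'); exists s, v'; split=> //; rewrite rE hE.
  by move=> z _ [s [v' [_ []]]]; rewrite {1}rE hE => /uP ->.
pose g r := some_or (R^~ r) (f r).
exists g; last first.
  move=> r rA; rewrite /g; case: some_orP => [w [Pw _]|nR].
    by split=> [v _ uv|/(_ w)//]; exact: uv.
  by split=> // v Pv uv; case: (nR v).
split=> [r rA|].
  rewrite /g; case: some_orP => [v [Pv _]|_]; last exact: fA.
  have [s sv] := Pi r v rA Pv; have svA := vin_dom sv (rA _).
  apply: (@vin_dom _ (upair s v)); first by apply/vin_upair; right.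
  by apply: vin_dom svA; apply/vin_opair; right.
apply: Delta0_ext (Delta0_or dR (Delta0_and (Delta0_not (Delta0_ex i.+1
  (Delta0_ex_opair 0 (Delta0_ren h dR)))) df)) => r rA /=.
have rtA : val (tail r) by move=> n; exact: rA.
rewrite -/(tail r) /g; case: some_orP => [v [Pv uv]|nR].
  split=> [[[P0 _]|[nex _]]|->]; [by apply: uv|exfalso|by left].
  have [s sv] := Pi (tail r) v rtA Pv.
  by apply: nex; exists (opair s v) => //; exists s, v; split.
split=> [[/nR//|[]//]|rf]; right; split=> // -[z _ [s [v [_]]]].
exact: nR.
Qed.

(** Being the graph of [f] on [r i] only needs quantifiers bounded by the graph and by [r i].
    Functions defined by replacement can therefore be nested, which is how codes of unions of
    complements of unions are built. *)
Lemma Dfun_graph i f : Dfun f ->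
  exists2 g, Dfun g & forall r, val r -> is_vset (g r) /\
    forall z, vin z (g r) <-> exists2 a, vin a (r i) & z = opair a (f (scons a r)).
Proof.
move=> Df; pose G r w := is_vset w /\
    forall z, vin z w <-> exists2 a, vin a (r i) & z = opair a (f (scons a r)).
have Dp := Dfun_opair (Dfun_var 0) Df.
have gE r : val r -> exists2 w, dom w & G r w.
  by move=> rA; have [w [wA wv wE]] := replacement Dp rA (rA i); exists w.
have gU r w w' : G r w -> G r w' -> w = w'.
  by move=> [vw wE] [vw' w'E]; apply: vset_ext => // z; rewrite wE w'E.
pose g r := some_or (G r) vempty.
have gP r : val r -> dom (g r) /\ G r (g r).
  move=> rA; have [w wA wG] := gE r rA; rewrite /g.
  by case: some_orP => [w' w'G|/(_ w)//]; rewrite {1}(gU _ _ _ w'G wG).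
exists g; last by move=> r /gP[].
split=> [r /gP[]//|]; case: Dp => _ dp.
pose h n := match n with 0 => 1 | 1 => 0 | n.+2 => n.+3 end.
pose h' n := match n with 0 => 0 | 1 => 1 | n.+2 => n.+3 end.
apply: Delta0_ext (Delta0_and (Delta0_vset 0) (Delta0_and
  (Delta0_all 0 (Delta0_ex i.+2 (Delta0_ren h dp)))
  (Delta0_all i.+1 (Delta0_ex 1 (Delta0_ren h' dp))))) => r rA /=.
have rtA : val (tail r) by move=> n; exact: rA.
have hE a z : tail (fun n => scons a (scons z r) (h n)) = scons a (tail r).
  by apply: funext => -[].
have h'E a z : tail (fun n => scons z (scons a r) (h' n)) = scons a (tail r).
  by apply: funext => -[].
have [_ gG] := gP _ rtA.
split=> [[vr [h1 h2]]|->].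
  apply: gU gG; split=> // z; split=> [/h1[a ai]|[a ai ->]].
    by rewrite hE => ->; exists a.
  by have [z' z'r] := h2 a ai; rewrite h'E => <-.
have [vg gE'] := gG; split=> //; split=> [z /gE'[a ai ->]|a ai].
  by exists a => //; rewrite hE.
exists (opair a (f (scons a (tail r)))); last by rewrite h'E.
by apply/gE'; exists a.
Qed.

End Definability.

(** * Codes of Borel sets *)

Section Codes.
Variables (L : language) (A : structure L) (e : nat -> obj (urel A)).
Variables (X : Type) (B : nat -> set X).
Hypotheses (A_adm : admissible A) (eA : omega_copy e).
Notation U := (obj (urel A)).
Notation dom := (@Defs.dom L A).
Notation val := (@valuation L A).
Implicit Types (s : set (nat * nat)) (u v w z : U).

Lemma vin_code_set (D : set nat) z : vin z (code_set e D) <-> exists2 n, D n & z = e n.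
Proof. exact: vin_collect_in. Qed.

Lemma vin_code_map s z :
  vin z (code_map e s) <-> exists2 p, s p & z = opair (e p.1) (e p.2).
Proof. exact: vin_collect_in. Qed.

Lemma vin_e_code_set (D : set nat) n : vin (e n) (code_set e D) <-> D n.
Proof.
by rewrite vin_code_set; split=> [[m Dm /(proj1 eA) ->]//|Dn]; exists n.
Qed.

Lemma code_map_inj : injective (code_map e).
Proof.
move=> s s' ss'; have H a b : s (a, b) <-> s' (a, b).
  have E s0 : s0 (a, b) <-> vin (opair (e a) (e b)) (code_map e s0).
    rewrite vin_code_map; split=> [h|[[a' b'] h]]; first by exists (a, b).
    by move=> /opair_inj[/(proj1 eA)-> /(proj1 eA)->].
  by rewrite !E ss'.
by apply/seteqP; split=> -[a b] /H.
Qed.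

Lemma dom_omega : dom (code_set e setT).
Proof.
have [_ h] := eA; apply: (vin_dom A_adm (y := upair (code_set e setT) (code_set e setT))).
  by apply/vin_upair; left.
by apply: (vin_dom A_adm) h; apply/vin_opair; left.
Qed.

Lemma dom_e n : dom (e n).
Proof. by apply: (vin_dom A_adm) dom_omega; apply/vin_e_code_set. Qed.

Definition enumerates w (F : nat -> U) :=
  is_vset w /\ forall z, vin z w <-> exists n, z = opair (e n) (F n).

Section Enumerates.
Variables (w : U) (F : nat -> U).
Hypothesis wF : enumerates w F.

Lemma vin_enumerates n v : vin (opair (e n) v) w <-> v = F n.
Proof.
rewrite (proj2 wF); split=> [[m /opair_inj[/(proj1 eA)-> //]]|->].
by exists n.
Qed.

Lemma enumerates_function : is_function w.
Proof.
case: wF => vw wE; split=> // [z /wE[n ->]|a b b']; first by exists (e n), (F n).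
by move=> /wE[n /opair_inj[-> ->]] /vin_enumerates ->.
Qed.

Lemma vdom_enumerates : vdom w = range e.
Proof.
apply/seteqP; split=> a /=.
  by case=> b /(proj2 wF)[n /opair_inj[-> _]]; exists n.
by case=> n _ <-; exists (F n); apply/vin_enumerates.
Qed.

Lemma vrng_enumerates : vrng w = range F.
Proof.
apply/seteqP; split=> a /=.
  by case=> b /(proj2 wF)[n /opair_inj[_ ->]]; exists n.
by case=> n _ <-; exists (e n); apply/vin_enumerates.
Qed.

Lemma BSigma_one_enumerates : (forall n, F n = vempty \/ F n = vone) ->
  BSigma e vone w.
Proof.
move=> F01; apply: BSigma_one; [exact: enumerates_function|exact: vdom_enumerates|].
by rewrite vrng_enumerates => _ [n _ <-]; exact: F01.
Qed.

Lemma BSigma_succ_enumerates alpha beta :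
  is_ordinal beta -> vin vone beta -> vin alpha beta ->
  (forall z, vin z beta <-> vin z alpha \/ z = alpha) ->
  (forall n, exists2 gamma, vin gamma beta & BPi e gamma (F n) \/ BSigma e gamma (F n)) ->
  BSigma e beta w.
Proof.
move=> ob b1 ab bE Fn; apply: BSigma_gt1 => //.
- exact: enumerates_function.
- by move=> [_ []]; exists alpha.
- by move=> _; exact: vdom_enumerates.
- by rewrite vrng_enumerates => _ [n _ <-].
Qed.

End Enumerates.

Lemma BSigma_function alpha u : BSigma e alpha u -> is_function u.
Proof. by case. Qed.

(** The empty set is vacuously a function, so it has to be excluded through its domain: the domain
    of a code is the copy of omega or a limit ordinal containing [vone]. *)
Lemma BSigma_neq0 alpha u : BSigma e alpha u -> u <> vempty.
Proof.
have e0 v : vdom v = range e -> v <> vempty.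
  move=> ve v0; have : vdom v (e 0) by rewrite ve; exists 0.
  by rewrite v0 => -[y /vin_empty].
case=> [v _ ve _|beta v ob b1 _ lim suc _]; first exact: e0.
have [sb|nsb] := pselect (is_successor beta); first by apply: e0; exact: suc.
have lb : is_limit beta by split=> // b0; move: b1; rewrite b0 => /vin_empty.
move=> v0; have : vdom v vone by rewrite (lim lb).
by rewrite v0 => -[y /vin_empty].
Qed.

Lemma Bcode_not01 u D : Bcode e B u D -> ~ (u = vempty \/ u = vone).
Proof.
have S01 alpha v : BSigma e alpha v -> ~ (v = vempty \/ v = vone).
  move=> av [v0|v1]; first exact: BSigma_neq0 av v0.
  by apply: (@vone_not_function (urel A)); rewrite -v1; exact: BSigma_function av.
case=> [v /S01//|alpha v E _ _|alpha v E _ /S01//].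
by case=> [/opair_neq0|/opair_neq1].
Qed.

Lemma BSigma_one_inv u : BSigma e vone u -> exists n y, vin (opair (e n) y) u /\
  (y = vempty \/ y = vone).
Proof.
move: {-1}vone (erefl (vone : U)) => alpha av au; case: au av => [v _ ve v01 _|].
  have : vdom v (e 0) by rewrite ve; exists 0.
  by case=> y vy; exists 0, y; split=> //; apply: v01; exists (e 0).
by move=> beta v _ b1 _ _ _ _ b1'; move: b1; rewrite -b1' vin_one => /vone_neq0.
Qed.

Lemma Bcode_one_union u (E : U -> set X) :
  BSigma e vone u -> (forall u', vrng u u' -> Bcode e B u' (E u')) -> False.
Proof.
move=> /BSigma_one_inv[n [y [uy y01]]] uE.
by apply: Bcode_not01 y01; apply: uE; exists (e n).
Qed.

(** Unique readability of codes. It allows a family of sets indexed by numbers to be reindexed by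
    their codes, even if several indices share one code. *)
Lemma Bcode_inj u D D' : Bcode e B u D -> Bcode e B u D' -> D = D'.
Proof.
move=> uD; elim: uD D' => {u D} [u u1|alpha u D uS uD IH|alpha u E a1 uS uE IH] D' uD'.
- move: uD' u1; case=> [//|alpha v D _ _ v1|alpha v E _ _ vE v1].
    by case: (opair0_not_function (BSigma_function v1)).
  by case: (Bcode_one_union v1 vE).
- move: {-2}(opair vempty u) uD' (erefl (opair vempty u)) => v; case.
  + by move=> v' /BSigma_function + vE; rewrite -vE => /opair0_not_function.
  + by move=> alpha' v' D0 _ vD' /opair_inj[_ uv]; rewrite (IH D0)// uv.
  + by move=> alpha' v' E _ /BSigma_function + _ vE; rewrite -vE => /opair0_not_function.
- move: uD' uS uE IH; case=> [v v1 _ vE|alpha' v D0 _ _ vS|alpha' v E' _ _ vE' _ _ IH].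
    by case: (Bcode_one_union v1 vE).
  by case: (opair0_not_function (BSigma_function vS)).
  apply: eq_bigcupr => u' vu'.
  by apply: IH => //; exact: vE'.
Qed.

Lemma Bcode_enumerates alpha w F (D : nat -> set X) :
  enumerates w F -> vin vone alpha -> BSigma e alpha w ->
  (forall n, Bcode e B (F n) (D n)) -> Bcode e B w (\bigcup_n D n).
Proof.
move=> wF a1 aw FD; pose E u := some_or (Bcode e B u) set0.
have FE n : E (F n) = D n.
  rewrite /E; case: some_orP => [D' /Bcode_inj|/(_ _ (FD n))//].
  by apply; exact: FD.
have -> : \bigcup_n D n = \bigcup_(u in vrng w) E u.
  rewrite (vrng_enumerates wF); apply/seteqP; split=> x [].
    by move=> n _ Dx; exists (F n); [exists n|rewrite FE].
  by move=> _ [n _ <-]; rewrite FE => Dx; exists n.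
apply: Bcode_union aw _ => //; rewrite (vrng_enumerates wF) => _ [n _ <-].
by rewrite FE.
Qed.

End Codes.

(** * Codes of the back-and-forth sets *)

Section BackForthSets.
Variables (G : set Sinf) (X : Type) (act : Sinf -> X -> X) (B : nat -> set X) (x : X).

Definition extend (b : bool) (s : set (nat * nat)) (m n : nat) : set (nat * nat) :=
  s `|` [set if b then (m, n) else (n, m)].

(* [bf b 0 s] is the closure of [V_s x]; for [b] (resp. [~~ b]) the set
   [bf b k s] describes [k] rounds of the game in which the first player adds
   points to the domain (resp. the range) of [s]. *)
Fixpoint bf (b : bool) (k : nat) (s : set (nat * nat)) : set X :=
  if k is k'.+1 then
    [set y | forall m, exists n, Sfin (extend b s m n) /\ bf b k' (extend b s m n) y]
  else [set y | forall l, B l y -> F1 G act B x s l].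

Variables (L : language) (A : structure L) (e : nat -> obj (urel A)).
Hypotheses (A_adm : admissible A) (xA : codable e G act B x).
Hypothesis B_cover : forall y, exists n, B n y.
Notation U := (obj (urel A)).
Notation dom := (@Defs.dom L A).
Notation val := (@valuation L A).
Implicit Types (s : set (nat * nat)) (u v w z : U).

Let eA : omega_copy e := proj1 xA.
Let om := code_set e setT.

Lemma vin_code_map_extend b s m n z :
  vin z (code_map e (extend b s m n)) <->
  vin z (code_map e s) \/ z = opair (e (if b then m else n)) (e (if b then n else m)).
Proof.
rewrite !vin_code_map; split=> [[p [sp|->] ->]|[[p sp ->]|->]].
- by left; exists p.
- by right; case: b.
- by exists p => //; left.
- by exists (if b then (m, n) else (n, m)); [right|case: b].
Qed.

Let graph := collect_in (I := nat * nat -> Prop) Sfin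
    (fun s => opair (code_map e s) (code_set e (F1 G act B x s))).

Lemma vin_graph z : vin z graph <->
  exists2 s, Sfin s & z = opair (code_map e s) (code_set e (F1 G act B x s)).
Proof. exact: vin_collect_in. Qed.

(** The set of codes of finite maps is recovered as the domain of the function given by codability,
    cut out of a double union of that function. *)
Lemma dom_Sfin : exists2 a, dom a &
  forall z, vin z a <-> exists2 s, Sfin s & z = code_map e s.
Proof.
have gA : dom graph by exact: (proj2 xA).
have [a aA ag] := dom_union A_adm gA; have [c cA ca] := dom_union A_adm aA.
have [d [dA _ dE]] := separation A_adm (Delta0_ex A_adm 1
  (Delta0_ex_opair A_adm 0 (Delta0_eq A 3 1))) (fun=> gA) cA.
exists d => // z; rewrite dE; split=> [[_ [p /vin_graph[s sF ->]]]|[s sF ->]] /=.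
  by move=> [u [v [/opair_inj[<- _] ->]]]; exists s.
have sg : vin (opair (code_map e s) (code_set e (F1 G act B x s))) graph.
  by apply/vin_graph; exists s.
split; last first.
  by exists (opair (code_map e s) (code_set e (F1 G act B x s))) => //; do 2 eexists.
apply: (ca _ (upair (code_map e s) (code_map e s))); first by apply/vin_upair; left.
by apply: ag sg; apply/vin_opair; left.
Qed.

(** The uniformity in [s] carries the induction over the rounds: a single element [w] of [A] holds
    codes for all the [D s], all of complement form and of the same level. *)
Definition coded (alpha : U) (D : set (nat * nat) -> set X) :=
  exists (u : set (nat * nat) -> U) w,
  [/\ dom w, forall z, vin z w <-> exists2 s, Sfin s & z = opair (code_map e s) (u s)
    & forall s, Sfin s -> BPi e alpha (u s) /\ Bcode e B (u s) (D s)].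

Lemma enumerates_graph (g : (nat -> U) -> U) (r : nat -> U) w :
  (is_vset w /\ forall z, vin z w <-> exists2 a, vin a om & z = opair a (g (scons a r))) ->
  enumerates e w (fun n => g (scons (e n) r)).
Proof.
move=> [vw wE]; split=> // z; rewrite wE; split=> [[_ /vin_code_set[n _ ->] ->]|[n ->]].
  by exists n.
by exists (e n) => //; apply/vin_e_code_set.
Qed.

Lemma coded_of_Dfun alpha D g r : Dfun g -> val r ->
  (forall s, Sfin s -> BPi e alpha (g (scons (code_map e s) r)) /\
    Bcode e B (g (scons (code_map e s) r)) (D s)) -> coded alpha D.
Proof.
move=> Dg rA gs; have [a aA aE] := dom_Sfin.
have [w [wA _ wE]] := replacement A_adm (Dfun_opair A_adm (Dfun_var A 0) Dg) rA aA.
exists (fun s => g (scons (code_map e s) r)), w; split=> // z; rewrite wE.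
split=> [[_ /aE[s sF ->] ->]|[s sF ->]]; first by exists s.
by exists (code_map e s) => //; apply/aE; exists s.
Qed.

Lemma coded0 b : coded vone (bf b 0).
Proof.
have gA : dom graph by exact: (proj2 xA).
pose r : nat -> U := scons om (scons graph (fun=> vempty)).
have rA : val r.
  do 2 (apply: val_scons; [by []||exact: dom_omega A_adm eA|]).
  by move=> n; exact: (adm_empty A_adm).
have DP := Delta0_ex A_adm 3 (Delta0_ex_opair A_adm 0
   (Delta0_and (Delta0_eq A 1 4) (Delta0_mem A 3 0))).
(* Variables of [f], from 0 on: [e n], the code of [s], omega and [graph]. The value 1 marks the
   numbers outside of [F1], because the closure of V_s x is coded as the complement of the union of
   the [B n] missing V_s x. *)
pose f (q : nat -> U) : U := if pselect (exists2 p, vin p (q 3) &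
  exists u v, p = opair u v /\ u = q 1 /\ vin (q 0) v) then vempty else vone.
have Df : Dfun f := Dfun_if DP (Dfun_empty A_adm) (Dfun_one A_adm).
have [h Dh hE] := Dfun_graph A_adm 1 Df.
apply: (coded_of_Dfun (Dfun_opair A_adm (Dfun_empty A_adm) Dh) rA) => s sF.
have sA : val (scons (code_map e s) r).
  apply: val_scons => //; have [a aA aE] := dom_Sfin.
  by apply: (vin_dom A_adm) aA; apply/aE; exists s.
have wF := enumerates_graph (hE _ sA); set w := h _ in wF *.
set F := (F in enumerates e w F) in wF.
have FE n : F n = if pselect (F1 G act B x s n) then vempty else vone.
  have E : (exists2 p, vin p graph & exists u v,
      p = opair u v /\ u = code_map e s /\ vin (e n) v) <-> F1 G act B x s n.
    split=> [[_ /vin_graph[s' _ ->] [u [v [/opair_inj[<- <-] []]]]]|ns].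
      by move=> /(code_map_inj eA) -> /(vin_e_code_set eA).
    exists (opair (code_map e s) (code_set e (F1 G act B x s))).
      by apply/vin_graph; exists s.
    by do 2 eexists; split; [reflexivity|split=> //; apply/(vin_e_code_set eA)].
  rewrite /F /f /=; case: pselect => /= [/E ns|nP]; case: pselect => //= ns'.
  by case: nP; apply/E.
have w1 : BSigma e vone w.
  by apply: (BSigma_one_enumerates eA wF) => n; rewrite FE; case: pselect; [left|right].
split; first exact: BPi_intro.
have -> : bf b 0 s = ~` \bigcup_(n in [set n | vin (opair (e n) vone) w]) B n.
  apply/seteqP; split=> y /= => [yB [n]|yB l Bly].
    rewrite /= (vin_enumerates eA wF) FE => + Bny; have := yB n Bny.
    by case: pselect => // _ _ /vone_neq0.
  apply: contrapT => nF; apply: yB; exists l => //=.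
  by rewrite (vin_enumerates eA wF) FE; case: pselect.
exact: Bcode_compl w1 (Bcode_one _ w1).
Qed.

(** Finiteness of the level yields the countability demanded by [constructible]; the last clause
    puts [vone] into every later level. *)
Definition good_ordinal (alpha : U) :=
  [/\ dom alpha, is_ordinal alpha, finite_set (members alpha) & alpha = vone \/ vin vone alpha].

Definition succ_of (alpha beta : U) :=
  is_vset beta /\ forall z, vin z beta <-> vin z alpha \/ z = alpha.

Lemma good_succ alpha : good_ordinal alpha ->
  exists2 beta, good_ordinal beta & succ_of alpha beta.
Proof.
move=> [aA ao ac a1]; have [b [bA bv bE]] := dom_succ A_adm aA.
exists b => //; split=> //; first exact: ordinal_succ bE.
  have -> : members b = members alpha `|` [set alpha].
    by apply/seteqP; split=> z /bE.
  by rewrite finite_setU; split=> //; exact: finite_set1.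
by right; apply/bE; case: a1 => [->|]; [right|left].
Qed.

(** One round is an intersection over [m] of unions over [n], that is, the complement of a union of
    complements of unions: the inner unions live at level [beta], the outer one at [gamma]. *)
Lemma coded_succ b k alpha beta gamma : good_ordinal alpha ->
  succ_of alpha beta -> good_ordinal beta -> succ_of beta gamma -> good_ordinal gamma ->
  coded alpha (bf b k) -> coded gamma (bf b k.+1).
Proof.
move=> [_ _ _ a1] [_ bE] [_ ob _ _] [_ gE] [_ og _ _] [u [w [wA wE uP]]].
pose r : nat -> U := scons om (scons w (fun=> vempty)).
have rA : val r.
  apply: val_scons; first exact: dom_omega A_adm eA.
  by apply: val_scons => // n; exact: (adm_empty A_adm).
(* [g0] is the constant function 1 on omega; it codes the whole space, which the basis covers. Its
   complement, a code of the empty set, serves as the default when [extend b s m n] is not in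
   [Sfin]. *)
have [g0 Dg0 g0E] := Dfun_graph A_adm 3 (Dfun_one A_adm).
(* Variables of [P], from 0 on: the code looked up, [e n], [e m], the code of
   [s], [omega] and the function [w] mapping codes of maps to codes of sets. *)
pose P (q : nat -> U) := exists2 p, vin p (q 5) & exists c v, p = opair c v /\
  (v = q 0 /\ exists2 z, vin z c &
    (z = opair (if b then q 2 else q 1) (if b then q 1 else q 2) /\
     ((forall z', vin z' c -> vin z' (q 3) \/ z' = z) /\
     forall z', vin z' (q 3) -> vin z' c))).
have DP : Delta0 P.
  have := Delta0_ex A_adm 5 (Delta0_ex_opair A_adm 0 (Delta0_and (Delta0_eq A 0 3)
    (Delta0_ex A_adm 1 (Delta0_and
     (Delta0_opair A_adm 0 (if b then 6 else 5) (if b then 5 else 6))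
     (Delta0_and (Delta0_all A_adm 2 (Delta0_or (Delta0_mem A 0 8) (Delta0_eq A 0 1)))
      (Delta0_all A_adm 7 (Delta0_mem A 0 3))))))).
  by rewrite /P; case: (b).
have Pi q v : val q -> P (scons v q) -> exists c, vin (opair c v) (q 4).
  by move=> _ [p pq [c [v' [pE [/= v'E _]]]]]; exists c; rewrite -v'E -pE.
pose f0 (q : nat -> U) := opair vempty (g0 q).
have Df0 : Dfun f0 by apply: Dfun_opair => //; exact: Dfun_empty.
(* [g1] looks up the code of the extended position in [w], [g2] collects these codes over all [n],
   and [g3] collects the complements of the results over all [m]. *)
have [g1 Dg1 g1E] := Dfun_iota A_adm Pi DP Df0.
have [g2 Dg2 g2E] := Dfun_graph A_adm 2 Dg1.
pose f2 (q : nat -> U) := opair vempty (g2 q).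
have Df2 : Dfun f2 by apply: Dfun_opair => //; exact: Dfun_empty.
have [g3 Dg3 g3E] := Dfun_graph A_adm 1 Df2.
apply: (coded_of_Dfun (Dfun_opair A_adm (Dfun_empty A_adm) Dg3) rA) => s sF.
set q := scons _ r.
have qA : val q.
  apply: val_scons => //; have [a aA aE] := dom_Sfin.
  by apply: (vin_dom A_adm) aA; apply/aE; exists s.
have q1A m : val (scons (e m) q) by apply: val_scons qA; exact: dom_e A_adm eA _.
have q2A m n : val (scons (e n) (scons (e m) q)).
  by apply: val_scons; first exact: dom_e A_adm eA _.
have PE m n v : P (scons v (scons (e n) (scons (e m) q))) <->
    Sfin (extend b s m n) /\ v = u (extend b s m n).
  split=> [[p /wE[s' s'F ->]
      [c [v' [/opair_inj[<- <-] [/= <- [z zs' [zE [h1 h2]]]]]]]]|[mnF ->]].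
    suff <- : s' = extend b s m n by [].
    apply: (code_map_inj eA); apply: vset_ext; [by eexists|by eexists|] => z'.
    rewrite vin_code_map_extend; split=> [/h1[|->]|[/h2//|z'E]]; [by left| |].
      by right; rewrite zE; case: (b).
    by rewrite z'E; move: zs'; rewrite zE; case: (b).
  exists (opair (code_map e (extend b s m n)) (u (extend b s m n))).
    by apply/wE; exists (extend b s m n).
  exists (code_map e (extend b s m n)), (u (extend b s m n)); split=> //; split=> //.
  exists (opair (e (if b then m else n)) (e (if b then n else m))).
    by apply/vin_code_map_extend; right.
  split; first by rewrite /=; case: (b).
  split=> z; first by move=> /vin_code_map_extend.
  by move=> zs; apply/vin_code_map_extend; left.
have w0 m n : enumerates e (g0 (scons (e n) (scons (e m) q))) (fun=> vone).
  exact: (enumerates_graph (g := fun=> vone) (r := q) (g0E _ (q2A m n))).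
have w2 m := enumerates_graph (g2E _ (q1A m)).
have w3 := enumerates_graph (g := f2) (g3E _ qA).
have b1 : vin vone beta by apply/bE; case: a1 => [->|]; [right|left].
have ab : vin alpha beta by apply/bE; right.
pose D m n := [set y | Sfin (extend b s m n) /\ bf b k (extend b s m n) y].
have g1P m n :
    (exists2 delta, vin delta beta & BPi e delta (g1 (scons (e n) (scons (e m) q)))) /\
    Bcode e B (g1 (scons (e n) (scons (e m) q))) (D m n).
  have [g1v g10] := g1E _ (q2A m n).
  have [mnF|nF] := pselect (Sfin (extend b s m n)).
    rewrite (g1v (u (extend b s m n))); last 2 first.
    - exact/PE.
    - by move=> v' /PE[].
    have [uB uD] := uP _ mnF; split; first by exists alpha.
    by have -> : D m n = bf b k (extend b s m n) by apply/seteqP; split=> y // [].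
  rewrite g10 => [|v /PE[]//].
  have w01 : BSigma e vone (g0 (scons (e n) (scons (e m) q))).
    by apply: (BSigma_one_enumerates eA (w0 m n)) => _; right.
  split; first by exists vone => //; exact: BPi_intro.
  have -> : D m n = ~` \bigcup_(i in
      [set i | vin (opair (e i) vone) (g0 (scons (e n) (scons (e m) q)))]) B i.
    apply/seteqP; split=> y; first by case.
    case; have [i Biy] := B_cover y; exists i => //=.
    exact/(vin_enumerates eA (w0 m n)).
  exact: Bcode_compl w01 (Bcode_one _ w01).
have w2b m : BSigma e beta (g2 (scons (e m) q)).
  apply: (BSigma_succ_enumerates eA (w2 m) ob b1 ab) => // n.
  by have [[delta db dP] _] := g1P m n; exists delta => //; left.
have w2D m := Bcode_enumerates eA (w2 m) b1 (w2b m) (fun n => (g1P m n).2).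
have bg : vin beta gamma by apply/gE; right.
have g_1 : vin vone gamma by apply/gE; left.
have w3g : BSigma e gamma (g3 q).
  apply: (BSigma_succ_enumerates eA w3 og g_1 bg) => // m.
  by exists beta => //; left; exact: BPi_intro.
have w3D := Bcode_enumerates eA w3 g_1 w3g (fun m => Bcode_compl (w2b m) (w2D m)).
split; first exact: BPi_intro.
have -> : bf b k.+1 s = ~` \bigcup_m ~` \bigcup_n D m n.
  apply/seteqP; split=> y /= => [yD [m _]|yD m].
    by apply; have [n] := yD m; exists n.
  by apply: contrapT => nD; apply: yD; exists m => // -[n _ ymn]; apply: nD; exists n.
exact: Bcode_compl w3g w3D.
Qed.

Lemma coded_bf b k : exists2 alpha, good_ordinal alpha & coded alpha (bf b k).
Proof.
elim: k => [|k [alpha ga ca]].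
  exists vone; last exact: coded0.
  split; [|exact: ordinal_one| |by left].
    by apply: dom_upair => //; exact: (adm_empty A_adm).
  have -> : members (vone : U) = [set vempty].
    by apply/seteqP; split=> z /vin_one.
  exact: finite_set1.
have [beta gb ab] := good_succ ga; have [gamma gg bg] := good_succ gb.
by exists gamma => //; exact: coded_succ ga ab gb bg gg ca.
Qed.

Lemma constructible_bf b k s : Sfin s -> constructible e B (bf b k s).
Proof.
move=> sF; have [alpha [aA _ af _] [u [w [wA wE uP]]]] := coded_bf b k.
have [uB uD] := uP _ sF; exists (u s), alpha; split=> //.
- have /(vin_dom A_adm) - /(_ wA) pA : vin (opair (code_map e s) (u s)) w.
    by apply/wE; exists s.
  apply: (vin_dom A_adm (y := upair (code_map e s) (u s))).
    by apply/vin_upair; right.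
  by apply: (vin_dom A_adm) pA; apply/vin_opair; right.
- exact: finite_set_countable.
- by right.
Qed.

End BackForthSets.

(** * Baire category *)

(* [P n] collects the sets among which the player aiming at a nonempty
   intersection may choose the [n]-th one, in a Choquet game relative to [C]. *)
Lemma choquet_baire (T : topologicalType) (C : set T) (P : nat -> set (set T)) :
  (forall n U, open U -> U `&` C !=set0 ->
     exists V, [/\ P n V, open V, V `&` C !=set0 & closure V `<=` U]) ->
  (forall V : nat -> set T, (forall n, P n (V n)) ->
     (forall n, V n.+1 `<=` V n) -> (forall n, V n `&` C !=set0) ->
     exists2 y, C y & forall n, closure (V n) y) ->
  forall (O : nat -> set T) U, (forall n, open (O n)) ->
    open U -> U `&` C !=set0 ->
    (forall n W, open W -> W `<=` U -> W `&` C !=set0 -> W `&` O n `&` C !=set0) ->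
  exists y, [/\ U y, C y & forall n, O n y].
Proof.
move=> strat lim O U oO oU UC dO.
pose good (p : nat * set T) := [/\ open p.2, p.2 `<=` U & p.2 `&` C !=set0].
pose S := {p | good p}.
pose next (p q : S) := [/\ (sval q).1 = (sval p).1.+1, P (sval p).1 (sval q).2
  & closure (sval q).2 `<=` (sval p).2 `&` O (sval p).1].
have nextP (p : S) : {q | next p q}.
  apply: cid; case: p => -[n W] /= [/= oW WU WC].
  have [||V [PV oV VC VW]] := strat n (W `&` O n); first exact: openI.
    exact: dO.
  have gV : good (n.+1, V).
    split=> //=; apply: subset_trans WU; apply: subset_trans (@subset_closure _ V) _.
    by apply: subset_trans VW _ => y [].
  by exists (exist _ _ gV).
have gU : good (0, U) by split.
have [f [f0 fS]] := dependent_choice nextP (exist _ _ gU).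
have fn n : (sval (f n)).1 = n.
  by elim: n => [|n IH]; [rewrite f0|have [-> _ _] := fS n; rewrite IH].
have clo n : closure (sval (f n.+1)).2 `<=` (sval (f n)).2 `&` O n.
  by have [_ _] := fS n; rewrite fn.
have [|n|n|y Cy Vy] := lim (fun n => (sval (f n.+1)).2).
- by move=> n; have [_ + _] := fS n; rewrite fn.
- apply: subset_trans (@subset_closure _ _) _; apply: subset_trans (clo _) _.
  by move=> ? [].
- by case: (svalP (f n.+1)).
exists y; split=> // [|n]; last by have [] := clo n _ (Vy n).
by have [+ _] := clo 0 _ (Vy 0); rewrite f0.
Qed.

Section MetricBaire.
Import Order.TTheory GRing.Theory Num.Theory.

(** The admissible moves at stage [n] lie in a ball of radius 1/(n+1), so points of [C] picked from
    a decreasing sequence of moves form a Cauchy sequence, whose limit is in the closed set [C]. If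
    no [F n] had interior relative to [C], all their complements would be dense in [C]. *)
Lemma metric_baire (R : realType) (M : metricType R) (C : set M) (F : nat -> set M) :
  (forall D : set_system M, ProperFilter D -> cauchy D -> exists l : M, D --> l) ->
  (forall n, closed (F n)) -> closed C -> C !=set0 -> C `<=` \bigcup_n F n ->
  exists n (U : set M), [/\ open U, U `&` C !=set0 & U `&` C `<=` F n].
Proof.
move=> Mc cF cC C0 CF; apply: contrapT => nF.
have [n U oU [y [Uy Cy]]|V PV decV VC|||||y [_ Cy Fy]] :=
  @choquet_baire M C (fun n V => exists c : M, V `<=` ball c n.+1%:R^-1%R)
   _ _ (fun n => ~` F n) setT.
- have [r r0 rU] : exists2 r : R, (0 < r)%R & ball y r `<=` U.
    by apply/nbhs_ballP; exact: open_nbhs_nbhs.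
  (* A point of the closure is within [r / 2] of a point of the ball, hence within [r] of [y]; the
     second bound makes the move admissible. *)
  pose e := Num.min (r / 2)%R n.+1%:R^-1%R.
  have e0 : (0 < e)%R by rewrite lt_min divr_gt0//=.
  exists (interior (ball y e)); split.
  + exists y; apply: subset_trans (@interior_subset _ _) _.
    by apply: le_ball; rewrite ge_min lexx orbT.
  + exact: open_interior.
  + by exists y; split=> //; apply: nbhsx_ballx.
  + move=> z /(_ _ (nbhsx_ballx z _ (divr_gt0 r0 (ltr0Sn _ 1)))) [w [/interior_subset yw zw]].
    apply: rU; rewrite (splitr r); apply: ball_triangle (ball_sym zw).
    by apply: le_ball yw; rewrite ge_min lexx.
- pose v n := projT1 (cid (VC n)).
  have vP n : V n (v n) /\ C (v n) by rewrite /v; case: cid => ? [].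
  have vV n k : (n <= k)%N -> V n (v k).
    move=> nk; suff : V k `<=` V n by apply; have [] := vP k.
    elim: k nk => [|k IH]; first by rewrite leqn0 => /eqP ->.
    rewrite leq_eqVlt => /orP[/eqP -> //|nk]; apply: subset_trans (decV k) _; exact: IH.
  have [|l vl] := Mc (v @ \oo).
    apply: cauchy_exP => e e0; have [n _ nP] := near_infty_natSinv_lt (PosNum e0).
    have [c cV] := PV n; exists c; exists n => // k /= nk.
    apply: (@le_ball _ _ _ n.+1%:R^-1%R); last by apply: cV; exact: vV.
    exact/ltW/(nP n)/leqnn.
  exists l.
    by apply: (closed_cvg C _ _ l vl) => //; near=> n; have [] := vP n.
  move=> n; apply: (closed_cvg (closure (V n)) _ _ l vl); first exact: closed_closure.
  by exists n => // k /= nk; apply: subset_closure; exact: vV.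
- by move=> n; rewrite openC; exact: cF.
- exact: openT.
- by rewrite setTI.
- move=> n W oW _ WC; apply: contrapT => nW; apply: nF; exists n, W; split=> // y [Wy Cy].
  by apply: contrapT => nFy; apply: nW; exists y.
- by have [n _ Fn] := CF _ Cy; exact: (Fy n).
Unshelve. all: by end_near.
Qed.

End MetricBaire.

Lemma polish_baire (R : realType) (T : topologicalType) (C : set T) (F : nat -> set T) :
  polish R T -> (forall n, closed (F n)) -> closed C -> C !=set0 ->
  C `<=` \bigcup_n F n ->
  exists n (U : set T), [/\ open U, U `&` C !=set0 & U `&` C `<=` F n].
Proof.
move=> [[m [oE Tc] _]] cF cC C0 CF.
have cM (D : set T) : closed D -> @closed (Metric.Pack m) D.
  by rewrite -openC => oD; rewrite -(@openC (Metric.Pack m)) oE.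
have [n [U [oU UC UF]]] := metric_baire Tc (fun n => cM _ (cF n)) (cM _ cC) C0 CF.
by exists n, U; split=> //; rewrite -oE.
Qed.

(** The filter of maps agreeing with [f] on longer and longer initial segments converges pointwise
    to [f]. *)
Lemma nbhs_Sinf (f : Sinf) (U : set Sinf) : nbhs f U ->
  exists N, forall g : Sinf, (forall i, (i < N)%N -> g i = f i) -> U g.
Proof.
move=> /= [_ [[W oW <-] Wf WU]].
pose F : set_system {ptws nat -> nat} :=
  filter_from setT (fun N => [set g | forall i, (i < N)%N -> g i = f i]).
have FF : Filter F.
  apply: filter_from_filter; first by exists 0.
  move=> i j _ _; exists (maxn i j) => // g gf; split=> k ki; apply: gf.
    by rewrite leq_max ki.
  by rewrite leq_max ki orbT.
have : F --> (set_val f : {ptws nat -> nat}).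
  apply/pointwise_cvgP => k A /nbhs_singleton Ak; exists k.+1 => // g gf /=.
  by rewrite gf.
move=> /(_ W (open_nbhs_nbhs (conj oW Wf))) [N _ NW]; exists N => g gf.
by apply: WU; exact: NW.
Qed.

Lemma open_Sinf_eval i k : open [set g : Sinf | g i = k].
Proof.
exists [set g : {ptws nat -> nat} | g i = k] => //.
apply: (@open_comp _ _ (fun g : {ptws nat -> nat} => g i) [set k]).
  by move=> g _; exact: (@proj_continuous _ _ i).
exact: discrete_open.
Qed.

(** * Closed permutation groups *)

Lemma SinfM (f g : Sinf) i : perm_fun (f * g)%g i = f (g i).
Proof. by []. Qed.

Lemma SinfVK (f : Sinf) i : f (perm_fun (f^-1)%g i) = i.
Proof. by rewrite -SinfM mulgV. Qed.

Lemma SinfKV (f : Sinf) i : perm_fun (f^-1)%g (f i) = i.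
Proof. by rewrite -SinfM mulVg. Qed.

Lemma Sinf_inj (f : Sinf) : injective f.
Proof. by move=> i j fij; rewrite -(SinfKV f i) fij SinfKV. Qed.

Lemma open_cylinder (D : set nat) (f : Sinf) : finite_set D ->
  open [set g : Sinf | forall i, D i -> g i = f i].
Proof.
move=> /finite_seqP[s ->]; elim: s => [|k s IH].
  have -> : [set g : Sinf | forall i, [set` [::]] i -> g i = f i] = setT.
    by apply/seteqP; split=> g // _ i.
  exact: openT.
have -> : [set g : Sinf | forall i, [set` k :: s] i -> g i = f i] =
  [set g : Sinf | g k = f k] `&` [set g : Sinf | forall i, [set` s] i -> g i = f i].
  apply/seteqP; split=> g /=.
    by move=> gf; split=> [|i si]; apply: gf; rewrite /= inE ?eqxx// si orbT.
  by move=> [gk gs] i; rewrite inE => /orP[/eqP -> //|]; exact: gs.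
by apply: openI => //; exact: open_Sinf_eval.
Qed.

Lemma nbhs_subSinf (H : set Sinf) (f : H) (U : set H) : nbhs f U ->
  exists N, forall g : H, (forall i, (i < N)%N -> set_val g i = set_val f i) -> U g.
Proof.
move=> /= [_ [[W oW <-] Wf WU]].
have [N NW] := nbhs_Sinf (open_nbhs_nbhs (conj oW Wf)).
by exists N => g gf; apply: WU; exact: NW.
Qed.

Lemma open_cylinder_sub (H : set Sinf) (D : set nat) (f : Sinf) : finite_set D ->
  open [set g : H | forall i, D i -> set_val g i = f i].
Proof.
move=> fD; exists [set g : Sinf | forall i, D i -> g i = f i] => //.
exact: open_cylinder.
Qed.

Section ClosedGroup.
Variable G : set Sinf.
Hypotheses (G_subgroup : subgroup G) (G_closed : closed G).

Lemma VGsetP c g : VGset G c g <-> G g /\ forall i, c i -> g i = i.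
Proof.
split=> -[Gg h]; split=> //.
  by move=> i ci; apply: (h (i, i)); exists i.
by move=> _ [i ci <-] /=; exact: h.
Qed.

Lemma VGset_sub c g : VGset G c g -> G g. Proof. by case. Qed.

Lemma VGset1 c : VGset G c 1%g.
Proof. by apply/VGsetP; split=> //; case: G_subgroup. Qed.

Lemma VGsetM c f g : VGset G c f -> VGset G c g -> VGset G c (f * g)%g.
Proof.
case: G_subgroup => _ GM _ /VGsetP[Gf fc] /VGsetP[Gg gc]; apply/VGsetP.
by split=> [|i ci]; [exact: GM|rewrite SinfM gc// fc].
Qed.

Lemma VGsetV c f : VGset G c f -> VGset G c (f^-1)%g.
Proof.
case: G_subgroup => _ _ GV /VGsetP[Gf fc]; apply/VGsetP.
by split=> [|i ci]; [exact: GV|rewrite -{1}(fc _ ci) SinfKV].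
Qed.

Lemma NG_VGset c : finite_set c -> NG G (VGset G c).
Proof.
move=> fc; exists (restr id c) => //; exists 1%g, c; split=> //.
by case: G_subgroup.
Qed.

(** A pointwise limit of permutations need not be onto; stabilizing the inverses as well provides an
    inverse of the limit. *)
Lemma Sinf_limit (v : nat -> Sinf) : (forall n, G (v n)) ->
  (forall n i, (i < n)%N -> v n.+1 i = v n i /\
     perm_fun (v n.+1)^-1%g i = perm_fun (v n)^-1%g i) ->
  exists2 g, G g & forall n i, (i < n)%N -> g i = v n i.
Proof.
move=> Gv vS.
have vE n i k : (i < n)%N -> (n <= k)%N ->
    v k i = v n i /\ perm_fun (v k)^-1%g i = perm_fun (v n)^-1%g i.
  move=> lin; elim: k => [|k IH].
    by rewrite leqn0 => /eqP ->.
  rewrite leq_eqVlt => /orP[/eqP <- //|nk].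
  by have [-> ->] := vS k i (leq_trans lin nk); exact: IH.
pose f i := v i.+1 i; pose f' i := perm_fun (v i.+1)^-1%g i.
have fE n i : (i < n)%N -> f i = v n i.
  by move=> lin; have [-> _] := vE i.+1 i n (ltnSn i) lin.
have ff' : cancel f' f.
  move=> i; pose n := (maxn i (f' i)).+1.
  have lin : (i < n)%N by rewrite ltnS leq_maxl.
  rewrite (fE n) ?ltnS ?leq_maxr// /f'.
  by have [_ <-] := vE i.+1 i n (ltnSn i) lin; rewrite SinfVK.
have f'f : cancel f f'.
  move=> i; set j := f' (f i); have fij : f j = f i by exact: ff'.
  pose n := (maxn i j).+1; apply: (@Sinf_inj (v n)).
  by rewrite -!fE ?ltnS ?leq_maxr ?leq_maxl.
exists (mkperm (Bijective f'f ff')) => [|n i lin]; last exact: fE.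
apply: G_closed => U /nbhs_Sinf[N NU]; exists (v N); split=> //.
by apply: NU => i iN; rewrite -[RHS]/(f i) (fE N).
Qed.

(** A move at stage [n] decides both [g] and its inverse on the numbers below [n], so that
    decreasing moves converge by [Sinf_limit]. *)
Lemma VGset_baire c (U : set (VGset G c)) : open U -> U !=set0 -> ~ meagre U.
Proof.
move=> oU [u0 Uu0] [N nN UN].
pose P n (V : set (VGset G c)) := exists h : Sinf, V `<=` [set g : VGset G c |
  forall i, (i < n)%N -> set_val g i = h i /\ perm_fun (set_val g)^-1%g i = perm_fun h^-1%g i].
have [n V oV [h [Vh _]]|V PV decV VC||||n W oW _ [h [Wh _]]|g [Ug _ gN]] :=
  @choquet_baire _ setT P _ _ (fun n => ~` closure (N n)) U.
- have [N0 N0V] := nbhs_subSinf (open_nbhs_nbhs (conj oV Vh)).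
  pose m := maxn N0 n; pose f : Sinf := set_val h.
  (* Agreement with [f] at the preimages of the numbers below [m] decides the inverse on these
     numbers. *)
  pose D := `I_m `|` perm_fun (f^-1)%g @` `I_m.
  have fD : finite_set D.
    by rewrite finite_setU; split; [|apply: finite_image]; exact: finite_II.
  exists [set g : VGset G c | forall i, D i -> set_val g i = f i]; split.
  + exists f => g /= gD i lin; have lim : (i < m)%N by rewrite leq_max lin orbT.
    split; first by apply: gD; left.
    apply: (@Sinf_inj (set_val g)); rewrite SinfVK gD ?SinfVK//.
    by right; exists i.
  + exact: open_cylinder_sub.
  + by exists h.
  + move=> g clg; apply: N0V => i iN0.
    have [|k [kD kg]] := clg [set k |
        forall i, `I_N0 i -> perm_fun (set_val k) i = perm_fun (set_val g) i].
      by apply: open_nbhs_nbhs; split=> //; apply: open_cylinder_sub; exact: finite_II.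
    by rewrite -kg//; apply: kD; left; rewrite /= leq_max iN0.
- pose v n : VGset G c := projT1 (cid (VC n)).
  have vV n : V n (v n) by rewrite /v; case: cid => ? [].
  have VP n k : (n <= k)%N -> V n (v k).
    move=> nk; suff : V k `<=` V n by apply.
    elim: k nk => [|k IH]; first by rewrite leqn0 => /eqP ->.
    rewrite leq_eqVlt => /orP[/eqP -> //|nk]; apply: subset_trans (decV k) _; exact: IH.
  have [|n i lin|g Gg gv] := @Sinf_limit (fun n => set_val (v n)).
  + by move=> n; apply: (@VGset_sub c); exact: set_valP.
  + have [h Vh] := PV n.
    by have [-> ->] := Vh _ (VP n n.+1 (leqnSn n)) i lin; have [-> ->] := Vh _ (vV n) i lin.
  have Hg : VGset G c g.
    apply/VGsetP; split=> // i ci; rewrite (gv i.+1)//.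
    by have /VGsetP[_] := set_valP (v i.+1); exact.
  exists (exist _ g (mem_set Hg)) => // n U' /nbhs_subSinf[N' N'U].
  exists (v (maxn n N')); split; first by apply: VP; exact: leq_maxl.
  by apply: N'U => i iN'; rewrite /= (gv (maxn n N'))// leq_max iN' orbT.
- by move=> n; rewrite openC; exact: closed_closure.
- exact: oU.
- by exists u0.
- apply: contrapT => WN; have : interior (closure (N n)) h.
    apply: filterS (open_nbhs_nbhs (conj oW Wh)) => k Wk.
    by apply: contrapT => nk; apply: WN; exists k.
  by rewrite (nN n).
- by have [n _ Nn] := UN _ Ug; apply: (gN n); exact: subset_closure.
Qed.

End ClosedGroup.

(** * Isolated points of the canonical piece *)

Lemma polish_separate (R : realType) (T : topologicalType) (p q : T) :
  polish R T -> p <> q -> exists U : set T, [/\ open U, U p & ~ U q].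
Proof.
move=> [[m [oE _] _]] pq.
have /hausdorff_accessible/(_ p q) : hausdorff_space (Metric.Pack m).
  exact: metric_hausdorff.
case; first exact/eqP.
move=> U [oU pU qU]; exists U; split; first by rewrite -oE.
  exact: set_mem.
exact: set_mem qU.
Qed.

Section NiceAction.
Variables (R : realType) (G : set Sinf) (X : Type) (t : Topological X).
Variables (act : Sinf -> X -> X) (B : nat -> set X).
Hypotheses (G_subgroup : subgroup G) (G_closed : closed G).
Hypotheses (t_polish : polish R (topsp t)) (G_act : is_action G act).
Hypotheses (act_cont : continuous_action G act t).
Hypothesis B_nice : nice_basis G act t (range B).
Implicit Types (g h v : Sinf) (c d : set nat) (x y z : X) (k l m n : nat).

Let openB l : @open (topsp t) (B l).
Proof. by case: B_nice => -[+ _] _; apply; exists l. Qed.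

Lemma basis_in (U : set X) y : @open (topsp t) U -> U y -> exists2 l, B l y & B l `<=` U.
Proof.
move=> oU Uy; case: B_nice => -[_ /(_ y U)] + _; rewrite nbhsE /=.
by case=> [|V [[l _ <-] By] BU]; [exists U|exists l].
Qed.

Lemma basis_cover y : exists n, B n y.
Proof. by have [l ly _] := @basis_in setT y openT I; exists l. Qed.

Let actM g h x : G g -> G h -> act (g * h)%g x = act g (act h x).
Proof. by move=> Gg Gh; rewrite (proj2 G_act). Qed.

Let act1 x : act 1%g x = x. Proof. exact: (proj1 G_act). Qed.

Let GM g h : G g -> G h -> G (g * h)%g. Proof. by case: G_subgroup => _ + _; exact. Qed.
Let GV g : G g -> G (g^-1)%g. Proof. by case: G_subgroup => _ _; exact. Qed.
Let G1 : G 1%g. Proof. by case: G_subgroup. Qed.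

Let actK g x : G g -> act (g^-1)%g (act g x) = x.
Proof. by move=> Gg; rewrite -actM ?mulVg//; exact: GV. Qed.

Let actVK g x : G g -> act g (act (g^-1)%g x) = x.
Proof. by move=> Gg; rewrite -actM ?mulgV//; exact: GV. Qed.

Lemma act_nbhs g y (U : set X) : G g -> @open (topsp t) U -> U (act g y) ->
  exists N (W : set X), [/\ @open (topsp t) W, W y &
    forall h z, G h -> (forall i, (i < N)%N -> h i = g i) -> W z -> U (act h z)].
Proof.
move=> Gg oU Uy; pose g0 : G := exist _ g (mem_set Gg).
have : nbhs ((g0, y) : G * topsp t) ((fun p : G * topsp t => act (set_val p.1) p.2) @^-1` U).
  by apply: act_cont; apply: open_nbhs_nbhs; split.
move=> [[Q W] /= [/nbhs_subSinf[N NQ] Wy] QW].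
move: (Wy : nbhs (y : topsp t) W); rewrite nbhsE => -[W' [oW' W'y] W'W].
exists N, W'; split=> // h z Gh hg W'z.
apply: (QW (exist _ h (mem_set Gh) : G, z)); split=> /=; last exact: W'W.
exact: NQ.
Qed.

Lemma open_act g (U : set X) : G g -> @open (topsp t) U ->
  @open (topsp t) [set z | U (act g z)].
Proof.
move=> Gg oU; rewrite openE => z /= Uz; have [N [W [oW Wz WU]]] := act_nbhs Gg oU Uz.
by apply: filterS (open_nbhs_nbhs (conj oW Wz)) => w Ww; exact: WU.
Qed.

(** For fixed [y], the set of all [v] in V_c with [act v y] in [B l] is open in V_c; by Baire it is
    meagre only if it is empty. *)
Lemma saturation_basis c l : finite_set c ->
  exists m, B m = [set y | exists2 v, VGset G c v & B l (act v y)].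
Proof.
move=> fc; case: B_nice => _ [_ _ BC Bv _].
have [m' _ E] : range B (~` B l) by apply: BC; exists l.
have : range B (~` vaught act (~` B l) (VGset G c)).
  by apply/BC/Bv; [rewrite -E; exists m'|exact: NG_VGset].
case=> m _ mE; exists m; rewrite mE; apply/seteqP; split=> y /=.
  move=> nv; apply: contrapT => nB; apply: nv; rewrite /vaught /comeagre /=.
  exists (fun=> set0) => [n|[g gc] /= /contrapT Bg].
    by rewrite /nowhere_dense closure0 interior0.
  by case: nB; exists g => //; exact: set_mem.
move=> [v vc Bv' [N nN NB]].
have : meagre [set g : VGset G c | B l (act (set_val g) y)].
  exists N => // g Bg; apply: NB => /=; exact.
apply: VGset_baire => //.
  rewrite openE => g /= Bg.
  have Gg : G (set_val g) by apply: (@VGset_sub _ c); exact: set_valP.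
  have [n [W [_ Wy WB]]] := act_nbhs Gg (openB l) Bg.
  have /open_nbhs_nbhs : open_nbhs g [set h : VGset G c |
      forall i, `I_n i -> perm_fun (set_val h) i = perm_fun (set_val g) i].
    by split=> //; apply: open_cylinder_sub; exact: finite_II.
  apply: filterS => h hg; apply: WB => //.
  by apply: (@VGset_sub _ c); exact: set_valP.
by exists (exist _ v (mem_set vc)).
Qed.

(* [y] is in the closure of the orbit of [z] under the pointwise stabilizer of
   [c]. *)
Definition below c z y := forall l, B l y -> exists2 v, VGset G c v & B l (act v z).

(** The saturation of [B l] under V_c is a basic set itself, so [below] applies to it. *)
Lemma below_basis c l z y : finite_set c -> below c z y ->
  (exists2 v, VGset G c v & B l (act v y)) -> exists2 v, VGset G c v & B l (act v z).
Proof.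
move=> fc zy [v vc Bv]; have [m mE] := saturation_basis l fc.
have [w wc] : exists2 w, VGset G c w & B m (act w z) by apply: zy; rewrite mE; exists v.
rewrite mE => -[w' w'c Bw]; exists (w' * w)%g; first exact: VGsetM.
by rewrite actM//; exact: (@VGset_sub _ c).
Qed.

(** If [y] missed the saturation of a basic set around [z], the complement of the saturation would
    be a basic set around [y]; it is invariant under V_c and avoids [z], hence its whole orbit. So
    the closures of the V_c-orbits partition the space. *)
Lemma below_sym c z y : finite_set c -> below c z y -> below c y z.
Proof.
move=> fc zy l Bz; apply: contrapT => nB.
have [m mE] := saturation_basis l fc.
have [m' _ m'E] : range B (~` B m) by case: B_nice => _ [_ _ BC _ _]; apply: BC; exists m.
have [v vc] : exists2 v, VGset G c v & B m' (act v z).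
  by apply: zy; rewrite m'E mE.
rewrite m'E mE; apply; exists (v^-1)%g; first exact: VGsetV.
by rewrite actK//; exact: (@VGset_sub _ c).
Qed.

Lemma below_trans c w z y : finite_set c -> below c w z -> below c z y -> below c w y.
Proof. by move=> fc wz zy l /zy; exact: below_basis. Qed.

(** Conjugation by [g] turns the stabilizer of [c] into that of its image under [g], which contains
    [d]. *)
Lemma below_act c d g z y : G g -> (forall i, d i -> exists2 j, c j & g j = i) ->
  below c z y -> below d (act g z) (act g y).
Proof.
move=> Gg dc zy l Bl; have [l' l'y l'B] := basis_in (open_act Gg (openB l)) Bl.
have [v /[dup]vc /VGsetP[Gv vE] Bv] := zy l' l'y; exists (g * v * g^-1)%g.
  apply/VGsetP; split=> [|_ /dc[j cj <-]]; first by do !apply: GM => //; exact: GV.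
  by rewrite !SinfM SinfKV vE.
have Gi := GV Gg; have Ggv := GM Gg Gv.
by rewrite !actM// actK//; exact: l'B.
Qed.

Lemma belowS c d z y : c `<=` d -> below d z y -> below c z y.
Proof.
move=> cd zy l /zy[v /VGsetP[Gv vd] Bv]; exists v => //.
by apply/VGsetP; split=> // i /cd; exact: vd.
Qed.

Lemma below_VGset c v z : VGset G c v -> below c z (act v z).
Proof. by move=> vc l Bl; exists v. Qed.

Lemma finite_nat_bounded c : finite_set c -> exists N, c `<=` `I_N.
Proof.
move=> /finite_seqP[s ->]; elim: s => [|k s [N sN]]; first by exists 0 => i.
exists (maxn k.+1 N) => i /=; rewrite inE leq_max => /orP[/eqP -> |/sN /= ->].
  by rewrite ltnSn.
by rewrite orbT.
Qed.

Variable x : X.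
Notation C := (canonical_piece G act (range B) x).

Lemma VGset0 v : VGset G set0 v <-> G v.
Proof. by rewrite VGsetP; split=> [[]|Gv]. Qed.

Lemma canonical_pieceP y : C y <-> below set0 x y.
Proof.
split=> [[h1 h2] l Bl|xy].
  have [[g [b [Gg Bb] xE]]|nx] := pselect (translate act G (B l) x).
    exists (g^-1)%g; first by apply/VGset0; exact: GV.
    by rewrite xE actK.
  case: (h2 (B l)); first by split=> //; exists l.
  by exists 1%g, y; rewrite ?act1.
have tE z l : translate act G (B l) z <-> exists2 v, VGset G set0 v & B l (act v z).
  split=> [[g [b [Gg Bb] ->]]|[v /VGset0 Gv Bv]].
    by exists (g^-1)%g; [apply/VGset0; exact: GV|rewrite actK].
  by exists (v^-1)%g, (act v z); [split=> //; exact: GV|rewrite actK].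
have yx := below_sym (finite_set0 _) xy.
split=> _ [[l _ <-]].
  by move=> /tE lx; apply/tE; exact: below_basis (finite_set0 _) yx lx.
by move=> nx /tE ly; apply: nx; apply/tE; exact: below_basis (finite_set0 _) xy ly.
Qed.

Lemma canonical_piece_act g y : G g -> C y -> C (act g y).
Proof.
move=> Gg /canonical_pieceP xy; apply/canonical_pieceP.
apply: below_trans (finite_set0 _) xy _; apply: below_VGset; exact/VGset0.
Qed.

Lemma canonical_piece_refl : C x.
Proof.
apply/canonical_pieceP; rewrite -{2}(act1 x); apply: below_VGset; exact/VGset0.
Qed.

Lemma closed_canonical_piece : @closed (topsp t) C.
Proof.
rewrite -openC openE => y /= /canonical_pieceP nC.
have /existsNP[l /not_implyP[Bl nl]] := nC.
apply: filterS (open_nbhs_nbhs (conj (openB l) Bl)) => z Bz /canonical_pieceP xz.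
exact/nl/xz.
Qed.

(* The two halves of "[x] and [y] satisfy the same types": every tuple of [x]
   (resp. of [y]) is matched by a tuple of [y] (resp. of [x]). *)
Definition matched := forall y, C y -> forall c, finite_set c ->
  (exists2 g, G g & below c x (act (g^-1)%g y)) /\
  (exists2 g, G g & below c (act g x) y).

(** The counterpart of an atomic model: the type of every finite tuple is isolated, within the piece
    [C]. *)
Definition isolated z := forall c, finite_set c ->
  exists U, [/\ @open (topsp t) U, U z & forall y, C y -> U y -> below c z y].

Lemma isolated_base : matched -> isolated x.
Proof.
move=> mx c /finite_nat_bounded[N cN].
(* For [g] in [G] with values [s] below [N], [F s] is the closure of the translate by [g] of the
   orbit of [x] under the stabilizer of [I_N]. *)
pose F (s : seq nat) := [set y | forall l, B l y ->
  exists g, [/\ G g, (forall i, (i < N)%N -> g i = nth 0%N s i) & B l (act g x)]].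
have cF s : @closed (topsp t) (F s).
  rewrite -openC openE => y /= /existsNP[l /not_implyP[Bl nl]].
  by apply: filterS (open_nbhs_nbhs (conj (openB l) Bl)) => z Bz /(_ l Bz).
have [n|y Cy|n [U [oU [y [Uy Cy]] UF]]] := @polish_baire R (topsp t) C
  (fun n => if unpickle n is Some s then F s else set0) t_polish _
  closed_canonical_piece (ex_intro _ x canonical_piece_refl).
- by case: unpickle => //; exact: closed0.
- have [[g Gg xy] _] := mx y Cy `I_N (finite_II _).
  exists (pickle [seq g i | i <- iota 0 N]) => //; rewrite pickleK => l Bl.
  have Bl' : B l (act g (act (g^-1)%g y)) by rewrite actVK.
  have [l' l'y l'B] := basis_in (open_act Gg (openB l)) Bl'.
  have [v /VGsetP[Gv vN] Bv] := xy l' l'y.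
  exists (g * v)%g; split; [exact: GM| |by rewrite actM//; exact: l'B].
  by move=> i iN; rewrite SinfM vN// (nth_map 0%N) ?size_iota// nth_iota.
move: UF; case: unpickle => [s|]; last by move=> /(_ y (conj Uy Cy)).
move=> UF.
have [l ly lU] := basis_in oU Uy.
have [h /VGset0 Gh Bh] := (canonical_pieceP y).1 Cy l ly.
have Chx := canonical_piece_act Gh canonical_piece_refl.
have [g [Gg gs Bg]] := UF _ (conj (lU _ Bh) Chx) l Bh.
(* Since [act g x] lies in [B l], this is a neighbourhood of [x]. It is sent by [g] into [U], hence
   within [C] into [F s], and translating back by the inverse of [g] lands in the closure of the
   orbit under the stabilizer of [I_N]. *)
exists [set z | B l (act g z)]; split=> //; first exact: open_act.
move=> z Cz Bz; apply: (belowS cN) => k Bk.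
have Bk' : B k (act (g^-1)%g (act g z)) by rewrite actK.
have [k' k'z k'B] := basis_in (open_act (GV Gg) (openB k)) Bk'.
have Cgz := canonical_piece_act Gg Cz.
have [g' [Gg' g's Bg']] := UF _ (conj (lU _ Bz) Cgz) k' k'z.
exists (g^-1 * g')%g; last by rewrite actM//; [exact: k'B|exact: GV].
apply/VGsetP; split=> [|i iN]; first by apply: GM => //; exact: GV.
by rewrite SinfM g's// -gs// SinfKV.
Qed.

(** By the second half of [matched], [y] is in the closure of the V_d-orbit of some [act g x].
    Isolation of [x] over the preimage of [d] under [g] is carried to [act g x] by [g], and from
    there to [y] by an element of V_d moving [y] close to [act g x]. *)
Lemma isolated_piece y : matched -> C y -> isolated y.
Proof.
move=> mx Cy d fd; have [_ [g Gg gxy]] := mx y Cy d fd.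
pose c := perm_fun (g^-1)%g @` d.
have fc : finite_set c by exact: finite_image.
have dc i : d i -> exists2 j, c j & g j = i.
  by move=> di; exists (perm_fun (g^-1)%g i); [exists i|rewrite SinfVK].
have [U [oU Ux Uc]] := isolated_base mx fc.
have ygx := below_sym fd gxy.
have Ug : U (act (g^-1)%g (act g x)) by rewrite actK.
have [l lgx lU] := basis_in (open_act (GV Gg) oU) Ug.
have [v /[dup] vd /VGsetP[Gv _] Bv] := ygx l lgx.
exists [set z | U (act (g^-1)%g (act v z))]; split; [|exact: lU|].
  by apply: (open_act Gv (U := [set z | U (act (g^-1)%g z)])); apply: open_act => //; exact: GV.
move=> z Cz Uz.
have := Uc _ (canonical_piece_act (GV Gg) (canonical_piece_act Gv Cz)) Uz.
move=> /(below_act Gg dc); rewrite actVK// => gxvz.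
apply: (below_trans fd ygx); apply: (below_trans fd gxvz).
exact/(below_sym fd)/below_VGset.
Qed.

(** It is enough to move [z] by V_c into the neighbourhood that isolates [y] over [d]. *)
Lemma back_and_forth_step z y c d : matched -> C z -> C y -> finite_set c -> finite_set d ->
  below c z y -> exists2 w, VGset G c w & below d (act w z) y.
Proof.
move=> mx Cz Cy fc fd zy; have [U [oU Uy Ud]] := isolated_piece mx Cy fd.
have [l ly lU] := basis_in oU Uy; have [w wc Bw] := zy l ly.
exists w => //; apply: (below_sym fd); apply: Ud; last exact: lU.
by apply: canonical_piece_act => //; exact: VGset_sub wc.
Qed.

(** A basic set separating the two limits is clopen and invariant under the stabilizer of some
    [I_M]. For large [n] it would also separate the approximations at stage [n], although the
    closure of a V_(c n)-orbit cannot be split by a set invariant under V_(c n). *)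
Lemma below_limit a b y (av bv : nat -> Sinf) (c : nat -> set nat) : G a -> G b ->
  (forall n, G (av n)) -> (forall n, G (bv n)) ->
  (forall n i, (i < n)%N -> a i = av n i) -> (forall n i, (i < n)%N -> b i = bv n i) ->
  (forall n, `I_n `<=` c n) ->
  (forall n, below (c n) (act (av n) x) (act (bv n) y)) -> act a x = act b y.
Proof.
move=> Ga Gb Gav Gbv aE bE cI xy; apply: contrapT => abxy.
have [U [oU Ub nUa]] := polish_separate t_polish (nesym abxy).
have [l lb lU] := basis_in oU Ub.
have [_ [_ _ BC _ Binv]] := B_nice.
have oBC : @open (topsp t) (~` B l).
  by case: B_nice => -[+ _] _; apply; apply: BC; exists l.
have [H [[H1 _ HV] HG oH] Hl] := Binv _ (imageT B l).
have : nbhs (exist _ 1%g (mem_set G1) : G) [set g : G | H (set_val g)].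
  by apply: open_nbhs_nbhs; split.
move=> /nbhs_subSinf[M MH].
have VM v : VGset G `I_M v -> H v.
  by move=> /VGsetP[Gv vM]; apply: (MH (exist _ v (mem_set Gv))) => i; exact: vM.
have [N1 [W1 [_ W1y W1B]]] := act_nbhs Gb (openB l) lb.
have nla : (~` B l) (act a x) by move=> /lU.
have [N2 [W2 [_ W2x W2B]]] := act_nbhs Ga oBC nla.
pose n := maxn M (maxn N1 N2).
have Bb : B l (act (bv n) y).
  apply: W1B => // i iN; rewrite (bE n)//; apply: leq_trans iN _.
  by rewrite /n leq_max leq_max leqnn orbT.
have nBa : ~ B l (act (av n) x).
  apply: W2B => // i iN; rewrite (aE n)//; apply: leq_trans iN _.
  by rewrite /n !leq_max leqnn !orbT.
have [v /VGsetP[Gv vc] Bv] := xy n l Bb; apply: nBa.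
rewrite -(actK (act (av n) x) Gv); apply: Hl Bv; apply: HV; apply: VM.
apply/VGsetP; split=> // i iM; apply: vc; apply: cI => /=.
by apply: leq_trans iM _; rewrite leq_maxl.
Qed.

Lemma matched_orbit y : matched -> C y -> orb act G x y.
Proof.
move=> mx Cy.
(* Both points are moved, by [a] and by [b], and later moves multiply from the left by elements of
   V_d. Having [a i] and [b i] in [d] freezes these values; having [i] in [d] freezes the inverses
   of [a] and [b] at [i]. *)
pose good (p : nat * (Sinf * Sinf) * set nat) :=
  let: (n, (a, b), d) := p in [/\ [/\ G a, G b & finite_set d],
    below d (act a x) (act b y) & forall i, (i < n)%N -> [/\ d i, d (a i) & d (b i)]].
pose S := {p | good p}.
pose next (p q : S) := let: (n, (a, b), d) := sval p in
  let: (n', (a', b'), d') := sval q in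
  [/\ n' = n.+1, (exists2 w, VGset G d w & a' = (w * a)%g)
    & exists2 w, VGset G d w & b' = (w * b)%g].
have nextP (p : S) : {q | next p q}.
  apply: cid; case: p => -[[n [a b]] d] [[Ga Gb fd] ab dn].
  have Cax := canonical_piece_act Ga canonical_piece_refl.
  have Cby := canonical_piece_act Gb Cy.
  (* The values of [b] enter already here, so that the second move [w'], which fixes [d1], keeps
     them; those of [a] enter in [d2], after [a] has been updated. *)
  pose d1 := d `|` (`I_n.+1 `|` perm_fun b @` `I_n.+1).
  have fd1 : finite_set d1.
    by rewrite !finite_setU; do !split=> //; try apply: finite_image; exact: finite_II.
  have [w wd ab1] := back_and_forth_step mx Cax Cby fd fd1 ab.
  have Gw := VGset_sub wd; have Gwa := GM Gw Ga.
  pose d2 := d1 `|` perm_fun (w * a)%g @` `I_n.+1.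
  have fd2 : finite_set d2.
    by rewrite finite_setU; split=> //; apply: finite_image; exact: finite_II.
  have ba1 := below_sym fd1 ab1.
  have [w' w'd1 ba2] := back_and_forth_step mx Cby (canonical_piece_act Gw Cax) fd1 fd2 ba1.
  have Gw' := VGset_sub w'd1.
  have gq : good (n.+1, ((w * a)%g, (w' * b)%g), d2).
    split; first by split=> //; exact: GM.
      by rewrite !actM//; exact: below_sym.
    move=> i iS; split.
    - by left; right; left.
    - by right; exists i.
    - left; rewrite SinfM; case/VGsetP: w'd1 => _ ->; by right; right; exists i.
  exists (exist _ _ gq); split=> //; first by exists w.
  exists w' => //; case/VGsetP: w'd1 => _ w'E; apply/VGsetP; split=> // i di.
  by apply: w'E; left.
have xy0 : below set0 (act 1%g x) (act 1%g y) by rewrite !act1; exact/canonical_pieceP.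
have g0 : good (0, (1%g, 1%g), set0) by split.
have [f [f0 fS]] := dependent_choice nextP (exist _ _ g0).
pose av n := (sval (f n)).1.2.1; pose bv n := (sval (f n)).1.2.2.
pose cv n := (sval (f n)).2.
have fP n : [/\ [/\ G (av n), G (bv n) & finite_set (cv n)],
    below (cv n) (act (av n) x) (act (bv n) y)
    & forall i, (i < n)%N -> [/\ cv n i, cv n (av n i) & cv n (bv n i)]].
  have fn : (sval (f n)).1.1 = n.
    elim: n => [|n IH]; first by rewrite f0.
    move: (fS n); rewrite /next; case: (sval (f n)) IH => -[n1 [a b]] d /= ->.
    by case: (sval (f n.+1)) => -[n2 [a' b']] d' /= [].
  move: fn (svalP (f n)); rewrite /good /av /bv /cv.
  by case: (sval (f n)) => -[n1 [a b]] d /= ->.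
have fS' n : (exists2 w, VGset G (cv n) w & av n.+1 = (w * av n)%g) /\
    (exists2 w, VGset G (cv n) w & bv n.+1 = (w * bv n)%g).
  move: (fS n); rewrite /next /av /bv /cv.
  by case: (sval (f n)) => -[n1 [a b]] d; case: (sval (f n.+1)) => -[n2 [a' b']] d' [].
have lim (u u' w : Sinf) n i : u' = (w * u)%g -> VGset G (cv n) w ->
    (forall i, (i < n)%N -> cv n i /\ cv n (u i)) -> (i < n)%N ->
    u' i = u i /\ perm_fun (u'^-1)%g i = perm_fun (u^-1)%g i.
  move=> -> /VGsetP[_ wE] cu lin; have [ci cui] := cu i lin.
  split; first by rewrite SinfM wE.
  by apply: (@Sinf_inj (w * u)%g); rewrite SinfVK SinfM SinfVK wE.
have [|n i lin|a Ga aE] := @Sinf_limit _ G_closed av.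
- by move=> n; have [[]] := fP n.
- have [[w wc uE] _] := fS' n; apply: (lim _ _ w n) => // j jn.
  by have [_ _ /(_ j jn)[]] := fP n.
have [|n i lin|b Gb bE] := @Sinf_limit _ G_closed bv.
- by move=> n; have [[]] := fP n.
- have [_ [w wc uE]] := fS' n; apply: (lim _ _ w n) => // j jn.
  by have [_ _ /(_ j jn)[]] := fP n.
have abE : act a x = act b y.
  apply: (below_limit (av := av) (bv := bv) (c := cv)) => //.
  - by move=> n; have [[]] := fP n.
  - by move=> n; have [[]] := fP n.
  - by move=> n i /= lin; have [_ _ /(_ i lin)[]] := fP n.
  - by move=> n; have [] := fP n.
exists (b^-1 * a)%g; first by apply: GM => //; exact: GV.
by rewrite actM ?abE ?actK//; exact: GV.
Qed.

End NiceAction.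

(** * Invariance of the back-and-forth sets *)

Lemma borelC (T : topologicalType) (D : set T) : borel D -> borel (~` D).
Proof. by rewrite -setTD; exact: sigma_algebraCD. Qed.

Lemma borel_bigcup (T : topologicalType) (D : nat -> set T) :
  (forall n, borel (D n)) -> borel (\bigcup_n D n).
Proof. exact: sigma_algebra_bigcup. Qed.

Lemma borel_bigcap (T : topologicalType) (D : nat -> set T) :
  (forall n, borel (D n)) -> borel (\bigcap_n D n).
Proof.
move=> bD; rewrite -(setCK (\bigcap_n _)) setC_bigcap.
exact: (borelC (borel_bigcup (fun n => borelC (bD n)))).
Qed.

Lemma Sfin_set0 : Sfin set0.
Proof. by split; [exact: finite_set0|move=> ? ? ?|move=> ? ? ?]. Qed.

Section BackForthProperties.
Variables (G : set Sinf) (X : Type) (t : Topological X).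
Variables (act : Sinf -> X -> X) (B : nat -> set X).
Hypotheses (G_subgroup : subgroup G) (G_closed : closed G) (G_act : is_action G act).
Hypotheses (act_cont : continuous_action G act t).
Hypothesis B_nice : nice_basis G act t (range B).
Variable x : X.
Notation bf := (bf G act B x).
Notation C := (canonical_piece G act (range B) x).
Implicit Types (s : set (nat * nat)) (b : bool) (g : Sinf).

Lemma borel_bf b k s : @borel (topsp t) (bf b k s).
Proof.
elim: k s => [|k IH] s.
  have -> : bf b 0 s = ~` \bigcup_(l in [set l | ~ F1 G act B x s l]) B l.
    apply/seteqP; split=> y /= => [yB [l /= nl Bl]|yB l Bl]; first exact/nl/yB.
    by apply: contrapT => nl; apply: yB; exists l.
  apply: (@borelC (topsp t)); apply: sub_sigma_algebra; apply: bigcup_open => l _.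
  by case: B_nice => -[+ _] _; apply; exists l.
have -> : bf b k.+1 s = \bigcap_m \bigcup_n
    (if pselect (Sfin (extend b s m n)) then bf b k (extend b s m n) else set0).
  apply/seteqP; split=> y /= yD m.
    by move=> _; have [n [sF yn]] := yD m; exists n => //; case: pselect.
  by have [n _] := yD m I; case: pselect => //= sF yn; exists n.
apply: (@borel_bigcap (topsp t)) => m; apply: (@borel_bigcup (topsp t)) => n.
case: pselect => /= ?; first exact: IH.
exact: sigma_algebra0.
Qed.

Definition move_range g s : set (nat * nat) := [set (p.1, g p.2) | p in s].

Lemma Sfin_move_range g s : Sfin s -> Sfin (move_range g s).
Proof.
move=> [fs s1 s2]; split; first exact: finite_image.
  move=> m n n' [[? ?] sp /= [<- <-]] [[? ?] sp' /= [? <-]]; subst.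
  by congr (g _); apply: s1 sp sp'.
move=> m n n' [[? ?] sp /= [<- <-]] [[? ?] sp' /= [<- /Sinf_inj ?]]; subst.
exact: s2 sp sp'.
Qed.

(** The game is transported by letting [g] act on the ranges of the positions: an answer in the
    range is moved by [g], a challenge in the range is pulled back by its inverse. The empty
    position is fixed, so its sets are invariant. *)
Lemma bf_act b k s y g : G g -> bf b k s y -> bf b k (move_range g s) (act g y).
Proof.
move=> Gg; elim: k s => [|k IH] s /=.
  move=> yB l Bl; have oB : @open (topsp t) (B l).
    by case: B_nice => -[+ _] _; apply; exists l.
  have [l' l'y l'B] := basis_in B_nice (open_act act_cont Gg oB) Bl.
  have [[f [d [Gf fd sE]]] [_ [[h [Gh hs] <-] Bh]]] := yB l' l'y.
  have [_ GM _] := G_subgroup.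
  split; first exists (g * f)%g, d; first split=> //; first exact: GM.
    rewrite sE; apply/seteqP; split=> -[i j] /=.
      by case=> _ [k dk <-] /= [<- <-]; exists k.
    by case=> k dk [<- <-]; exists (k, f k) => //; exists k.
  exists (act (g * h)%g x); split; last by rewrite (proj2 G_act)//; exact: l'B.
  exists (g * h)%g => //; split; first exact: GM.
  by move=> _ [[i j] sij <-] /=; rewrite SinfM (hs _ sij).
move=> yk m; case: b IH yk => IH yk.
  have [n [sF yn]] := yk m; exists (g n).
  have -> : extend true (move_range g s) m (g n) = move_range g (extend true s m n).
    by rewrite /extend /move_range image_setU image_set1.
  by split; [exact: Sfin_move_range|exact: IH].
have [n [sF yn]] := yk (perm_fun (g^-1)%g m); exists n.
have -> : extend false (move_range g s) m n =
    move_range g (extend false s (perm_fun (g^-1)%g m) n).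
  by rewrite /extend /move_range image_setU image_set1 /= SinfVK.
by split; [exact: Sfin_move_range|exact: IH].
Qed.

(** From an identity position, the second player answers every [m] by [m] itself. *)
Lemma bf_id b k (c : set nat) : finite_set c -> bf b k (restr id c) x.
Proof.
elim: k c => [|k IH] c fc /=.
  move=> l Bl; split; first by exists 1%g, c; split=> //; case: G_subgroup.
  exists x; split=> //; exists 1%g; last exact: (proj1 G_act).
  exact: (VGset1 G_subgroup c).
move=> m; exists m.
have -> : extend b (restr id c) m m = restr id (c `|` [set m]).
  by rewrite /extend /restr image_setU image_set1; case: (b).
have fcm : finite_set (c `|` [set m]).
  by rewrite finite_setU; split=> //; exact: finite_set1.
split; last exact: IH.
split; first exact: finite_image.
  by move=> i j j' [? _ [<- <-]] [? _ [<- <-]].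
by move=> i i' j [? _ [<- <-]] [? _ [<- <-]].
Qed.

Lemma bf0_canonical b : bf b 0 set0 = C.
Proof.
apply/seteqP; split=> y.
  move=> yB; apply/(canonical_pieceP G_subgroup G_closed G_act act_cont B_nice) => l Bl.
  by have [_ [_ [[g [Gg _] <-] Bg]]] := yB l Bl; exists g => //; exact/VGset0.
move=> /(canonical_pieceP G_subgroup G_closed G_act act_cont B_nice) yB l.
move=> /yB[g /VGset0 Gg Bg]; split.
  exists 1%g, set0; split=> //; [by case: G_subgroup|by rewrite /restr image_set0].
by exists (act g x); split=> //; exists g => //; split.
Qed.

(** The first player plays the [k] consecutive numbers from [j] on; [s'] is the final position. *)
Lemma bf_witness b k s y j : Sfin s -> bf b k s y ->
  exists s', [/\ s `<=` s', bf b 0 s' y &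
    forall i, (j <= i < j + k)%N -> exists n, s' (if b then (i, n) else (n, i))].
Proof.
elim: k s j => [|k IH] s j sF /= yk.
  exists s; split=> // i /andP[ji]; rewrite addn0 ltnNge => /negP[].
  exact: ji.
have [n [snF yn]] := yk j; have [s' [ss' ys' s'E]] := IH _ j.+1 snF yn.
exists s'; split=> // [|i /andP[ji ik]].
  by apply: subset_trans ss'; exact: subsetUl.
move: ji; rewrite leq_eqVlt => /orP[/eqP <-|ji].
  by exists n; apply: ss'; right.
by apply: s'E; rewrite ji addSnnS.
Qed.

(** The final position [s] after [N] rounds has [c] in its domain or in its range, and it is the
    restriction of some [f] in [G]. Any other [h] extending [s] differs from [f] by an element of
    V_c, on the right in the first case and on the left in the second. *)
Lemma matched_of_bf : (forall b k, C `<=` bf b k set0) -> matched G act B x.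
Proof.
move=> Cbf y Cy c /finite_nat_bounded[N cN].
have [_ GM GV] := G_subgroup.
have W b : exists s f d, [/\ G f, s = restr f d, bf b 0 s y
    & forall i, c i -> exists n, s (if b then (i, n) else (n, i))].
  have [s [_ sy sE]] := bf_witness 0 Sfin_set0 (Cbf b N y Cy).
  (* Any basic set around [y] will do: membership in [F1] contains the fact that [s] is a
     restriction of an element of [G]. *)
  have [l ly] := basis_cover B_nice y.
  have [[f [d [Gf _ sd]]] _] := sy l ly; exists s, f, d; split=> // i /cN iN.
  exact: sE.
have oB l : @open (topsp t) (B l) by case: B_nice => -[+ _] _; apply; exists l.
split.
  have [s [f [d [Gf sd sy sE]]]] := W true; exists f => // l Bl.
  have [l' l'y l'B] := basis_in B_nice (open_act act_cont (GV _ Gf) (oB l)) Bl.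
  have [_ [_ [[h [Gh hs] <-] Bh]]] := sy l' l'y.
  exists (f^-1 * h)%g; last first.
    by rewrite (proj2 G_act)//; [exact: l'B|exact: GV].
  apply/VGsetP; split=> [|i /sE[n sin]]; first by apply: GM => //; exact: GV.
  rewrite SinfM (hs _ sin : h i = n); move: sin; rewrite sd => -[j _ [-> <-]].
  exact: SinfKV.
have [s [f [d [Gf sd sy sE]]]] := W false; exists f => // l Bl.
have [_ [_ [[h [Gh hs] <-] Bh]]] := sy l Bl.
exists (h * f^-1)%g; last first.
  rewrite -(proj2 G_act)//; last by apply: GM => //; exact: GV.
  by rewrite -mulgA mulVg mulg1.
apply/VGsetP; split=> [|i /sE[n sni]]; first by apply: GM => //; exact: GV.
have hn : h n = i by exact: (hs _ sni).
move: sni; rewrite sd => -[j _ [jn fj]].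
by rewrite SinfM -{1}fj SinfKV jn.
Qed.

End BackForthProperties.

Theorem theorem30 (R : realType) (G : set Sinf) (X : Type)
  (tau t : Topological X) (act : Sinf -> X -> X) (B : nat -> set X)
  (L : language) (A : structure L) (e : nat -> obj (urel A)) (x : X)
  (G_subgroup : subgroup G)
  (G_closed : closed G)
  (X_polish : polish_Gspace G act R tau)
  (X_clopen_basis : exists2 Us : set (set (topsp tau)),
     countable Us & basis Us /\ Us `<=` clopen)
  (t_nice : nice_topology G act R tau t)
  (B_nice : nice_basis G act t (range B))
  (A_admissible : admissible A)
  (x_codable : codable e G act B x)
  (Imp_sigma : Imp_sigma_definable e G act B) :
  canonical_piece G act (range B) x = orb act G x <->
  canonical_piece G act (range B) x =
    \bigcap_(D in invariant_constructible e G act t B x) D.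
Proof.
have [_ G_act _] := X_polish; have [t_polish _ act_cont _] := t_nice.
have bf_ic b k : invariant_constructible e G act t B x (bf G act B x b k set0).
  split.
  - exact: borel_bf.
  - move=> g y Gg ybf; have := bf_act G_subgroup G_act act_cont B_nice Gg ybf.
    by rewrite /move_range image_set0.
  - by have := bf_id B G_subgroup G_act x b k (finite_set0 nat); rewrite /restr image_set0.
  - by apply: (constructible_bf A_admissible x_codable (basis_cover B_nice)); exact: Sfin_set0.
split=> [CE|CE].
  apply/seteqP; split=> y; first by rewrite CE => -[g Gg <-] D [_ Dinv Dx _]; exact: Dinv.
  rewrite -(bf0_canonical G_subgroup G_closed G_act act_cont B_nice x true).
  exact.
have mx : matched G act B x.
  apply: (matched_of_bf G_subgroup G_act act_cont B_nice) => b k; rewrite CE.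
  exact: bigcap_inf.
apply/seteqP; split=> y; first exact: (matched_orbit G_subgroup G_closed t_polish).
move=> [g Gg <-]; apply: (canonical_piece_act G_subgroup G_closed G_act act_cont B_nice) => //.
exact: canonical_piece_refl.
Qed.
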